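(* Let $\epsilon>0$ and set $\alpha\coloneqq(1+\epsilon)(\sqrt{2}-1)$. For each even $n$, let $H=H_n$ be a graph on vertex set $[n]$ with minimum degree $\delta(H)\geq \alpha n$. Then asymptotically almost surely $H\cup G_{n,1}$ is pancyclic, i.e., $\mathbb{P}[H_n\cup G_{n,1}\text{ is pancyclic}]\to 1$ as $n\to\infty$.
   Context: $G_{n,1}$ denotes a uniformly random perfect matching on vertex set $[n]=\{1,\dots,n\}$ ($n$ even), viewed as a graph. The union $H\cup G$ of two graphs on the same vertex set $[n]$ is the graph on $[n]$ whose edge set is $E(H)\cup E(G)$. A graph on $n$ vertices is pancyclic if it contains a cycle of length $k$ for every $3\leq k\leq n$. An event holds asymptotically almost surely if its probability tends to $1$ as $n\to\infty$. *)

(* Defs.v *)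
From mathcomp Require Import all_boot all_order all_algebra.

Set Implicit Arguments.
Unset Strict Implicit.
Unset Printing Implicit Defensive.

Import GRing.Theory Num.Theory.

Section Graphs.
Variable T : finType.
Implicit Types E M : {set {set T}}.

(* A finite simple graph on the vertex type T is given by its edge set, a set
   of 2-element subsets of T. The union of two graphs is then E1 :|: E2. *)
Definition simple_graph E := [forall e in E, #|e| == 2].

Definition degree E (x : T) : nat := #|[set e in E | x \in e]|.

(* In a simple graph every degree is below #|T| when T is nonempty, so the
   neutral element #|T| only matters for the graph with no vertices, whose
   minimum degree is thereby 0. *)
Definition min_degree E : nat := \big[minn/#|T|]_(x : T) degree E x.

Definition adjacent E : rel T := [rel x y | [set x; y] \in E].

(* For k >= 3: some k distinct vertices that are cyclically adjacent. *)
Definition has_cycle E (k : nat) : bool :=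
  [exists c : k.-tuple T, ucycleb (adjacent E) c].

Definition pancyclic E : bool :=
  [forall k : 'I_#|T|.+1, (3 <= k) ==> has_cycle E k].

Definition perfect_matching M : bool :=
  simple_graph M && [forall x, degree M x == 1].

End Graphs.

(* Probability that a uniformly random perfect matching on n vertices
   satisfies P; meaningful when n is even (for n odd the value is 0 / 0 = 0). *)
Definition matching_prob (R : realFieldType) (n : nat)
    (P : pred {set {set 'I_n}}) : R :=
  (#|[set M | perfect_matching M & P M]|%:R
     / #|[set M : {set {set 'I_n}} | perfect_matching M]|%:R)%R.

(* Main.v *)
(* The random matching is the edge set of a uniform fixed-point-free involution
   g, and the whole argument runs through the sets
       avail x y = { a | a in N_H(x), g a in N_H(y) }.
   If a path with ends x and y is disjoint from another path or cycle through
   the matching edge {a, g a} with a in avail x y, it can be inserted there, at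
   the cost of that single matching edge.

   Random input. Exposing the edges of g one at a time and comparing the
   branches by conjugation with transpositions bounds the exponential moments of
   #|avail x y|; hence a.a.s. #|avail x y| >= (alpha^2 - o(1)) n for all x, y.
   Moreover, for a fixed maximum matching m of H, a switching argument shows
   that a.a.s. only o(n) vertices lie on short cycles of m o g.

   Deterministic part. The matching m misses at most (1 - 2 alpha) n vertices, so
   the union of m and g splits into at most (1 - 2 alpha) n / 2 + o(n) paths and
   cycles. As alpha^2 + 2 alpha > 1, greedy insertion, always of a short piece
   into another piece, can continue until boundedly many pieces remain. A
   reservoir set aside beforehand, a cycle of size o(n) which contains many
   insertion edges for every pair x, y, then absorbs these pieces, or initial
   segments of them, which yields all cycle lengths from the size of the
   reservoir up to n. Shorter cycles come from closing a path by one matching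
   edge. *)

(* In this order the finset lemmas shadow their homonyms for classical sets, and
   the graph relation adjacent shadows a lemma on sequences. *)
From mathcomp Require Import all_classical all_reals all_analysis.
From mathcomp Require Import all_boot all_fingroup all_order all_algebra.
From mathcomp Require Import zify ring lra.
Require Import Defs.

Set Implicit Arguments.
Unset Strict Implicit.
Unset Printing Implicit Defensive.

Import Order.TTheory GRing.Theory Num.Theory.
Import numFieldNormedType.Exports.

(** * Inserting a path at a matching edge *)

Section Consecutive.
Variable T : eqType.
Implicit Types (a b x : T) (s l r : seq T).

Fixpoint consec a b s : bool :=
  if s is x :: s' then ((x == a) && (ohead s' == Some b)) || consec a b s'
  else false.

Lemma consec_mid l r a b : consec a b (l ++ a :: b :: r).
Proof. by elim: l => [|x l IH] /=; rewrite ?eqxx ?IH ?orbT. Qed.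

Lemma consecP a b s :
  reflect (exists l r, s = l ++ a :: b :: r) (consec a b s).
Proof.
apply: (iffP idP) => [|[l [r ->]]]; last exact: consec_mid.
elim: s => //= x s IH /orP[/andP[/eqP-> ]|/IH[l [r ->]]].
  by case: s {IH} => //= y s /eqP[->]; exists [::], s.
by exists (x :: l), r.
Qed.

Lemma consec_split l x r a b :
  consec a b (l ++ x :: r) = consec a b (rcons l x) || consec a b (x :: r).
Proof.
elim: l => [|y l IH]; first by rewrite /= andbF.
by rewrite cat_cons rcons_cons /= IH orbA; case: l {IH}.
Qed.

Lemma consec_catl s t a b : consec a b s -> consec a b (s ++ t).
Proof. by case/consecP=> l [r ->]; rewrite -catA /= consec_mid. Qed.

Lemma consec_catr s t a b : consec a b t -> consec a b (s ++ t).
Proof. by case/consecP=> l [r ->]; rewrite catA consec_mid. Qed.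

Lemma consec_rev s a b : consec a b s -> consec b a (rev s).
Proof.
case/consecP=> l [r ->]; rewrite rev_cat !rev_cons -!cats1 -!catA /=.
exact: consec_mid.
Qed.

Lemma consec_mem s a b : consec a b s -> (a \in s) && (b \in s).
Proof. by case/consecP=> l [r ->]; rewrite !mem_cat !inE !eqxx !orbT. Qed.

Lemma sorted_cat_cons_path (e : rel T) l x r :
  sorted e (l ++ x :: r) = sorted e (rcons l x) && path e x r.
Proof.
by case: l => //= y l; rewrite cat_path rcons_path /= andbA.
Qed.

End Consecutive.

Section Absorption.
Variables (T : finType) (h : rel T) (g : T -> T).
Hypotheses (hC : symmetric h) (gK : involutive g).
Implicit Types (x y a b t : T) (s p : seq T) (A W D X : {set T}).

Definition union_adj : rel T := [rel x y | h x y || (g x == y)].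
Local Notation e := union_adj.

Definition avail x y : {set T} := [set a | h x a && h (g a) y].

Definition linked s a := consec a (g a) s || consec (g a) a s.

(** Such a set is a union of whole matching edges. *)
Definition ends_closed A := forall x, x \in A -> g x \in A.

Lemma union_adj_sym : symmetric e.
Proof.
move=> x y; rewrite /e /= hC; congr (_ || _).
by apply/eqP/eqP => <-; rewrite gK.
Qed.

Lemma union_adjH x y : h x y -> e x y.
Proof. by rewrite /e /= => ->. Qed.

Lemma union_adjG x : e x (g x).
Proof. by rewrite /e /= eqxx orbT. Qed.

Lemma linked_mate s a : linked s (g a) = linked s a.
Proof. by rewrite /linked gK orbC. Qed.

Lemma linked_mem s a : linked s a -> a \in s.
Proof. by case/orP=> /consec_mem/andP[]. Qed.

Lemma linked_rev s a : linked s a -> linked (rev s) a.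
Proof.
by case/orP=> /consec_rev H; apply/orP; [right|left].
Qed.

(** The step from [a] to [g a] is replaced by a detour through [x :: p], whose two joining edges lie
    in [h]. All other steps survive, so only the edge at [a] stops being linked. *)
Lemma absorb_oriented l r a x p :
    h x a -> h (g a) (last x p) -> path e x p ->
  let s := l ++ a :: g a :: r in let s' := l ++ a :: x :: p ++ g a :: r in
  [/\ perm_eq s' (s ++ x :: p), sorted e s -> sorted e s',
      path.cycle e s -> path.cycle e s' &
      forall b, b != a -> b != g a -> linked s b || linked (x :: p) b ->
        linked s' b].
Proof.
move=> hxa hay ep s s'; split.
- rewrite /s /s' -catA perm_cat2l /= perm_cons -cat_cons -[g a :: r ++ _]/((g a :: r)
    ++ _).
  exact: permEl (perm_catC _ _).
- rewrite /s /s' !sorted_cat_cons_path => /andP[-> /=];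
    rewrite cat_path /= => /andP[_ ->].
  rewrite ep (@union_adjH a x) 1?hC //= andbT.
  by rewrite union_adj_sym union_adjH.
(* Both cycles are rotated to start at [a], which leaves conditions on paths. *)
- rewrite /s /s' -(rot_cycle (size l) e (l ++ a :: g a :: _)) rot_size_cat -(rot_cycle
    (size l) e (l ++ a :: x :: _)).
  rewrite rot_size_cat /= => /andP[_ H].
  rewrite (@union_adjH a x) 1?hC //= -catA rcons_cat cat_path ep /=.
  by rewrite union_adj_sym union_adjH.
move=> b ba bga; rewrite /linked.
have key c d : (c, d) != (a, g a) -> consec c d s || consec c d (x :: p) -> consec c d
  s'.
  move=> ncd; rewrite /s /s' consec_split => /orP[/orP[H|]|H].
  - by rewrite consec_split H.
  - move=> /= /orP[/andP[/eqP ac /eqP [gd]]|].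
      by rewrite -ac -gd eqxx in ncd.
    move=> H; rewrite -[_ :: _ :: _ ++ _]/((a :: x :: p) ++ g a :: r).
    exact/consec_catr/consec_catr.
  - rewrite consec_split; apply/orP; right.
    by rewrite -[_ :: _ :: _]/([:: a] ++ (x :: p) ++ g a :: r);
      apply/consec_catr/consec_catl.
have n1 : (b, g b) != (a, g a) by rewrite xpair_eqE (negPf ba).
have n2 : (g b, b) != (a, g a) by rewrite xpair_eqE (negPf bga) andbF.
by rewrite orbACA => /orP[/(key _ _ n1)->//|/(key _ _ n2)->]; rewrite orbT.
Qed.

(** If [s] runs from [g a] to [a], the path is inserted in reverse. *)
Lemma absorb s a x p :
    linked s a -> h x a -> h (g a) (last x p) -> path e x p ->
  exists s', [/\ perm_eq s' (s ++ x :: p), sorted e s -> sorted e s',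
      path.cycle e s -> path.cycle e s' &
      forall b, b != a -> b != g a -> linked s b || linked (x :: p) b ->
        linked s' b].
Proof.
case/orP=> /consecP[l [r ->]] hxa hay ep.
  by exists (l ++ a :: x :: p ++ g a :: r); apply: absorb_oriented.
have Erev : rev (x :: p) = last x p :: rev (belast x p).
  by rewrite lastI rev_rcons.
have elast : last (last x p) (rev (belast x p)) = x.
  by case: p {hay ep Erev} => //= y p; rewrite rev_cons last_rcons.
have ep' : path e (last x p) (rev (belast x p)).
  rewrite rev_path; apply: sub_path ep => u v; by rewrite /= -union_adj_sym.
have := @absorb_oriented l r (g a) (last x p) (rev (belast x p)).
rewrite gK elast hC hay hC hxa => /(_ isT isT ep') /= [H1 H2 H3 H4].
exists (l ++ g a :: last x p :: rev (belast x p) ++ a :: r); split=> //.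
  apply: perm_trans H1 _; rewrite perm_cat2l -Erev.
  by rewrite perm_rev.
move=> b ba bga H; apply: H4 => //; case/orP: H => [->//|H].
by rewrite -Erev linked_rev ?orbT.
Qed.

(* D contains the ends of the matching edges that insertions have used up. *)
Definition tiling W D (ss : seq (seq T)) :=
  [/\ uniq (flatten ss), flatten ss =i W,
      forall s, s \in ss -> sorted e s && (s != [::]) &
      forall a, a \in W -> a \notin D -> exists2 s, s \in ss & linked s a].

Lemma leq_size_flatten w (ss : seq (seq T)) :
  (forall s, s \in ss -> w <= size s) -> size ss * w <= size (flatten ss).
Proof.
elim: ss => [|s ss IH] H //=; rewrite size_cat mulSn leq_add ?H ?mem_head //.
by apply: IH => t ts; apply: H; rewrite inE ts orbT.
Qed.

(** As long as there are more than [K] pieces, one of them has fewer than [w] vertices and can be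
    inserted into another piece. The lower bound on [avail] leaves room to avoid that piece and all
    used edges. *)
Lemma tiling_coarsen K w W D ss :
    tiling W D ss -> #|T| < K.+1 * w ->
    (forall x y, w + #|D| + 2 * size ss <= #|avail x y :&: W|) ->
  exists ss' D', tiling W D' ss' /\ size ss' <= K.
Proof.
move=> + ltTKw; move: {2}(size ss) (leqnn (size ss)) => k.
elim: k ss D => [|k IH] ss D.
  by rewrite leqn0 size_eq0 => /eqP-> H _; exists [::], D.
move=> szk til av; have [szK|ltK] := leqP (size ss) K; first by exists ss, D.
case: (til) => ussf fW ssP lk.
have [p pss szp] : exists2 p, p \in ss & size p < w.
  apply/hasP; rewrite -[has _ _]negbK -all_predC; apply/negP => /allP H.
  have: size (flatten ss) <= #|T| by rewrite -(card_uniqP ussf) max_card.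
  have: size ss * w <= size (flatten ss).
    by apply: leq_size_flatten => s /H /=; rewrite -leqNgt.
  nia.
case Dp: p (ssP p pss) => [|x p'] //=.
rewrite andbT => ep; have := av x (last x p'); set V := avail _ _ => avx.
have : ~~ (V :&: W \subset D :|: [set y in p]).
  apply/negP => /subset_leq_card; rewrite cardsU.
  have: #|[set y in p]| <= size p by rewrite cardsE card_size.
  by move: avx szp; clear; lia.
case/subsetPn=> a; rewrite !inE negb_or => /andP[/andP[hxa hay] aW] /andP[aD ap].
have [s1 s1ss lks1] := lk a aW aD.
have s1p : s1 != p by apply: contraNneq ap => <-; apply: linked_mem.
have pe1 : perm_eq ss (p :: rem p ss) by apply: perm_to_rem.
have s1r : s1 \in rem p ss.
  by move: s1ss; rewrite (perm_mem pe1) inE (negPf s1p).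
set ss2 := rem s1 (rem p ss).
have pe2 : perm_eq ss (p :: s1 :: ss2).
  by apply: perm_trans pe1 _; rewrite perm_cons perm_to_rem.
have [s' [pes' es' _ lks']] := absorb lks1 hxa hay ep.
have pef : perm_eq (flatten ss) (flatten (s' :: ss2)).
  apply: perm_trans (perm_flatten pe2) _ => /=; rewrite catA perm_cat2r.
  by rewrite perm_sym; apply: perm_trans pes' _; rewrite -Dp perm_catC.
have szss : size ss = (size ss2).+2 by rewrite (perm_size pe2).
apply: (IH (s' :: ss2) (a |: (g a |: D))).
- by move: szk; rewrite szss.
- split.
  + by rewrite -(perm_uniq pef).
  + by move=> y; rewrite -(perm_mem pef).
  + move=> s; rewrite inE => /orP[/eqP->|sss2].
      have /andP[e1 _] := ssP _ s1ss; rewrite es' //=.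
      by apply/eqP => E; have := perm_size pes'; rewrite E size_cat /= addnS.
    by apply: ssP; rewrite (perm_mem pe2) !inE sss2 !orbT.
  + move=> b bW; rewrite !inE !negb_or => /and3P[ba bga bD].
    have [s + lks] := lk b bW bD;
      rewrite (perm_mem pe2) !inE => /or3P[/eqP E|/eqP E|ss2s].
    * by exists s'; rewrite ?mem_head // lks' // -Dp -E lks orbT.
    * by exists s'; rewrite ?mem_head // lks' // -E lks.
    * by exists s; rewrite // inE ss2s orbT.
(* [D] gains at most two points while one piece disappears, so [#|D| + 2 * size ss] does not
   grow. *)
- move=> u v; have := av u v.
  have: #|a |: (g a |: D)| <= #|D|.+2.
    by rewrite !cardsU1; apply: leq_add (leq_b1 _) (leq_add (leq_b1 _) (leqnn _)).
  rewrite /= szss; clear.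
  move: (size ss2) #|a |: (g a |: D)| #|avail u v :&: W| #|D| => ????; lia.
Qed.

(** The pieces enter the cycle [R] one after the other, the last one possibly truncated to reach
    length [k] exactly. Each insertion takes two points out of [A], whence the factor 2. *)
Lemma absorb_pieces (ps : seq (seq T)) R A k :
    path.cycle e R -> uniq (R ++ flatten ps) -> all (sorted e) ps ->
    (forall a, a \in A -> linked R a) ->
    (forall x y, 2 * size ps <= #|avail x y :&: A|) ->
    size R <= k <= size R + size (flatten ps) ->
  exists c, [/\ path.cycle e c, uniq c & size c = k].
Proof.
elim: ps R A => [|p ps IH] R A cR uR sps lkA av.
  by rewrite addn0 -eqn_leq => /eqP<-; exists R; rewrite -[R in uniq R]cats0.
rewrite /= in av; case: p sps uR => [|x p0] /= sps uR.
  by apply: IH cR uR sps lkA _ => x y; apply: leq_trans (av x y);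
    rewrite mulnS leq_addl.
case/andP=> leRk lek; have [Ek|neRk] := eqVneq (size R) k.
  by exists R; move: uR; rewrite cat_uniq => /and3P[-> _ _].
case/andP: sps => ep sps.
(* Together with [x] this is an initial segment of [k - size R] vertices, or the whole piece if that
   is shorter. *)
set p := take (k - size R).-1 p0.
have Ep0 := cat_take_drop (k - size R).-1 p0; rewrite -/p in Ep0.
have ep' : path e x p by move: ep; rewrite -Ep0 cat_path => /andP[].
have /set0Pn[a] : avail x (last x p) :&: A != set0.
  by rewrite -card_gt0; have:= av x (last x p); rewrite /=; lia.
rewrite !inE => /andP[/andP[hxa hay] aA].
have [R' [peR _ cR' lkR']] := absorb (lkA a aA) hxa hay ep'.
have [lek2|gtk] := leqP k (size R + (size p0).+1).
  exists R'; split; first exact: cR'.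
    rewrite (perm_uniq peR); move: uR; rewrite -Ep0.
    have -> : R ++ x :: (p ++ drop (k - size R).-1 p0) ++ flatten ps =
              (R ++ x :: p) ++ drop (k - size R).-1 p0 ++ flatten ps by rewrite -!catA.
    by rewrite cat_uniq => /andP[].
  rewrite (perm_size peR) size_cat /= /p size_take.
  by move: leRk neRk lek2; clear; case: ifP; lia.
have Epp: p = p0 by rewrite /p take_oversize //; move: gtk; clear; lia.
rewrite Epp in peR lkR'.
apply: (IH R' (A :\ a :\ g a)) => //; first exact: cR'.
- by rewrite (perm_uniq (s2 := R ++ (x :: p0) ++ flatten ps)) // catA perm_cat2r.
- by move=> b; rewrite !inE => /and3P[bga ba bA]; rewrite lkR' // lkA.
- move=> u v; have := av u v => /=.
  rewrite [#|_ :&: A|](cardsD1 a) (cardsD1 (g a) (_ :\ a)) => H.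
  have aux (b1 b2 : bool) n N : 2 * n.+1 <= b1 + (b2 + N) -> 2 * n <= N by clear; lia.
  apply: leq_trans (aux _ _ _ _ H) _.
  by apply/subset_leq_card/subsetP => b; rewrite !inE => /and3P[-> -> /andP[-> ->]].
- rewrite (perm_size peR) size_cat /=; move: lek gtk; rewrite size_cat; clear.
  by move: (size _) (size _) (size _) => ???; lia.
Qed.

End Absorption.

(** * The reservoir *)

Section Cover.
Variables (T I : finType) (S : I -> {set T}) (K w : nat).
Hypotheses (ltTKw : #|T| < K.+1 * w) (leS : forall i, w <= #|S i|).

(** Double counting: each [S i] misses less than a fraction K/(K+1) of the points, so some point is
    missed by at most that fraction of the sets. *)
Lemma cover_step (P : {set I}) :
  (0 < #|T|) -> exists a, K.+1 * #|[set i in P | a \notin S i]| <= K * #|P|.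
Proof.
move=> T_gt0.
have [/existsP //|] := boolP [exists a, K.+1 * #|[set i in P | a \notin S i]| <= K *
  #|P|].
rewrite negb_exists => /forallP H; exfalso.
have E : \sum_(a : T) #|[set i in P | a \notin S i]| = \sum_(i in P) #|~: S i|.
  transitivity (\sum_(a : T) \sum_(i in P) (a \notin S i)).
    apply: eq_bigr => a _; rewrite -sum1_card big_mkcond /= [RHS]big_mkcond /=.
    by apply: eq_bigr => i _; rewrite !inE; case: (i \in P).
  rewrite exchange_big /=; apply: eq_bigr => i _; rewrite -sum1_card [RHS]big_mkcond /=.
  by apply: eq_bigr => a _; rewrite !inE; case: (_ \in _).
have le1 : \sum_(i in P) #|~: S i| <= #|P| * (#|T| - w).
  rewrite -sum_nat_const; apply: leq_sum => i _.
  by rewrite cardsCs setCK leq_sub2l.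
have le2 : #|T| * (K * #|P|).+1 <= K.+1 * \sum_(a : T) #|[set i in P | a \notin S i]|.
  rewrite -sum_nat_const big_distrr /=; apply: leq_sum => a _.
  by rewrite ltnNge H.
move: le1 le2; rewrite E; move: (\sum_(i in P) _) #|P| => X N.
move: #|T| ltTKw T_gt0 => n; clear; nia.
Qed.

(** Greedy covering: each chosen point shrinks the family of sets not yet hit by the factor
    K/(K+1). *)
Lemma cover_iter q :
  (0 < #|T|) -> exists2 s : seq T, size s = q &
    K.+1 ^ q * #|[set i | all (fun a => a \notin S i) s]| <= K ^ q * #|I|.
Proof.
move=> T_gt0; elim: q => [|q [s sz IH]].
  exists [::] => //; rewrite !expn0 !mul1n; apply: max_card.
have [a Ha] := cover_step [set i | all (fun a => a \notin S i) s] T_gt0.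
exists (a :: s); first by rewrite /= sz.
have -> : [set i | all (fun b => b \notin S i) (a :: s)] =
   [set i in [set i | all (fun b => b \notin S i) s] | a \notin S i].
  by apply/setP => i; rewrite !inE /= andbC.
move: Ha IH; set X := #|_|; set Y := #|_|; rewrite !expnS => Ha IH.
apply: (@leq_trans (K.+1 ^ q * (K * Y)));
  first by rewrite -mulnA mulnCA leq_mul2l Ha orbT.
by rewrite mulnCA -mulnA leq_mul2l IH orbT.
Qed.

Lemma cover_exists q :
    0 < #|T| -> #|I| * K ^ q < K.+1 ^ q ->
  exists2 s : seq T, size s = q & forall i, has (fun a => a \in S i) s.
Proof.
move=> T_gt0 ltq; have [s sz Hs] := cover_iter q T_gt0.
exists s => // i; rewrite -[has _ _]negbK -all_predC; apply/negP => H.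
have : 0 < #|[set i | all (fun a => a \notin S i) s]|.
  by apply/card_gt0P; exists i; rewrite inE.
move: Hs ltq; set X := #|_|; clear; move: (K.+1 ^ q) (K ^ q) #|I| => A B C; nia.
Qed.

End Cover.

Section Reservoir.
Variables (T : finType) (h : rel T) (g : T -> T).
Hypotheses (hC : symmetric h) (gK : involutive g) (gN : forall x, g x != x).
Implicit Types (x y a b t : T) (A X : {set T}) (bs : seq T).
Local Notation e := (union_adj h g).

Definition mated bs := flatten [seq [:: v; g v] | v <- bs].

Lemma mem_mated bs x : (x \in mated bs) = (x \in bs) || (g x \in bs).
Proof.
elim: bs => //= b bs IH; rewrite !inE IH.
rewrite (_ : (x == g b) = (g x == b)); last by apply/eqP/eqP => [->|<-]; rewrite gK.
by case: (x == b); case: (g x == b); rewrite ?orbT.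
Qed.

Lemma size_mated bs : size (mated bs) = 2 * size bs.
Proof. by elim: bs => //= b bs ->; rewrite mulnS. Qed.

(** Such a list names matching edges by one end each, so [mated bs] lists their ends without
    repetition. *)
Definition independent_mates bs := uniq bs /\ forall v, v \in bs -> g v \notin bs.

Lemma uniq_mated bs : independent_mates bs -> uniq (mated bs).
Proof.
case; elim: bs => //= b bs IH /andP[bbs ubs] nbs.
have /andP[gbb gbbs] : (g b != b) && (g b \notin bs).
  by have := nbs b (mem_head _ _); rewrite inE negb_or.
rewrite IH // ?andbT ?inE ?negb_or ?(eq_sym b) ?gbb ?mem_mated ?gK ?(negPf bbs)
  ?(negPf gbbs) //.
by move=> v vbs; have := nbs v; rewrite !inE vbs orbT negb_or => /(_ isT) /andP[].
Qed.

Lemma mates_transversal A : ends_closed g A ->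
  exists2 bs, independent_mates bs & forall x, (x \in A) = (x \in mated bs).
Proof.
(* Of each edge the end of smaller rank is kept. *)
move=> Ag; exists [seq v <- enum A | enum_rank v < enum_rank (g v)].
  split=> [|v]; first by rewrite filter_uniq ?enum_uniq.
  by rewrite !mem_filter gK => /andP[lt _]; rewrite ltnNge (ltnW lt).
move=> x; rewrite mem_mated mem_filter [g x \in _]mem_filter !mem_enum gK.
have -> : (g x \in A) = (x \in A).
  by apply/idP/idP => /Ag //; rewrite gK.
case: (x \in A); rewrite ?andbF // !andbT -neq_ltn; apply/esym.
by rewrite (inj_eq val_inj) (inj_eq enum_rank_inj) eq_sym gN.
Qed.

(** Between an edge [b, g b] and the next one a fresh connecting edge [c, g c] is placed, so each
    entry of [bs] costs four vertices. [X] collects the vertices already taken. The vertex [u]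
    stands for the preceding entry in the recursion, and [t] for the vertex to be reached at the
    end. *)
Lemma link_chain bs X t :
    independent_mates bs -> (forall v, v \in bs -> v \notin X) -> ends_closed g X ->
    (forall x y, #|X| + 4 * size bs <= #|avail h g x y|) ->
  exists s, [/\ size s = 4 * size bs /\ ohead s = ohead bs, uniq s,
     forall x, x \in s -> (x \notin X) && (g x \in s),
     forall b, b \in bs -> linked g s b &
     forall u, h u (head t bs) -> path e u (rcons s t)].
Proof.
elim: bs X => [|b bs IH] X [ubs nbs] bsX Xg av.
  by exists [::]; split=> // u /= /union_adjH ->.
have /= /andP[bbs ubs'] := ubs.
have bX : b \notin X by apply: bsX; rewrite mem_head.
have gb_bs : g b \notin bs by have := nbs b (mem_head _ _);
  rewrite inE negb_or => /andP[].
have gbX : g b \notin X by apply: contra bX => /Xg; rewrite gK.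
have [c cV cN] : exists2 c, c \in avail h g (g b) (head t bs) & c \notin X :|: [set v
  in mated (b :: bs)].
  apply/subsetPn/negP => /subset_leq_card; rewrite leqNgt => /negP; apply.
  apply: leq_trans (av _ _); rewrite cardsU.
  have : #|[set v in mated (b :: bs)]| <= 2 * (size bs).+1.
    by rewrite cardsE; apply: leq_trans (card_size _) _; rewrite size_mated.
  by rewrite /=; move: #|X| #|_ :&: _| #|_| (size bs) => ????; clear; lia.
move: cN; rewrite in_setU in_set mem_mated !inE !negb_or => /andP[cX /andP[/andP[cb
  cbs] /andP[gcb gcbs]]].
have gcX : g c \notin X by apply: contra cX => /Xg; rewrite gK.
have cgb : c != g b by apply: contraNneq gcb => ->; rewrite gK.
have gcgb : g c != g b by rewrite (inj_eq (can_inj gK)).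
pose X' := b |: (g b |: (c |: (g c |: X))).
have nbs' v : v \in bs -> g v \notin bs.
  by move=> vbs; have := nbs v; rewrite !inE vbs orbT negb_or => /(_ isT) /andP[].
have [|v vbs|x|x y|s [[szs ohs] us sP lks ps]] := IH X'.
- by split.
- rewrite !inE !negb_or; apply/and5P; split.
  + by apply: contraNneq bbs => <-.
  + by apply: contraNneq gb_bs => <-.
  + by apply: contraNneq cbs => <-.
  + by apply: contraNneq gcbs => <-.
  + by apply: bsX; rewrite inE vbs orbT.
- rewrite !inE => /or4P[/eqP->|/eqP->|/eqP->|/orP[/eqP->|/Xg->]];
    rewrite ?gK ?eqxx ?orbT //.
- apply: leq_trans (av x y); rewrite /= mulnS addnA leq_add2r !cardsU1.
  move: (b \notin _) (g b \notin _) (c \notin _) (g c \notin _) #|X| => ?????; clear;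
    lia.
have sN x : x \in s -> [/\ x != b, x != g b, x != c, x != g c & x \notin X].
  by move=> /sP; rewrite !inE !negb_or => /andP[/and5P[]].
exists [:: b, g b, c, g c & s]; split.
- by rewrite /= szs mulnS.
- rewrite /= us !inE !negb_or andbT (eq_sym b) gN (eq_sym b) cb (eq_sym b) gcb.
  rewrite (eq_sym (g b)) cgb (eq_sym (g b)) gcgb (eq_sym c) gN.
  by rewrite !(introN idP) // => /sN[]; rewrite ?eqxx.
- move=> x; rewrite !inE => /or4P[/eqP->|/eqP->|/eqP->|/orP[/eqP->|xs]];
    rewrite ?gK ?eqxx ?orbT ?bX ?gbX ?cX ?gcX //.
  by have [_ _ _ _ ->] := sN x xs; have /andP[_ ->] := sP x xs; rewrite !orbT.
- move=> v; rewrite inE => /orP[/eqP->|/lks]; first by rewrite /linked /= !eqxx.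
  rewrite -[_ :: _]/([:: b; g b; c; g c] ++ s).
  by case/orP=> H; apply/orP; [left|right]; apply: consec_catr.
- move=> u hub; move: cV; rewrite inE => /andP[hbc hct].
  by rewrite /= (union_adjH _ hub) union_adjG (union_adjH _ hbc) union_adjG ps.
Qed.

(** Each of the [j] rounds covers the sets [avail x y], indexed by pairs, with the points chosen so
    far removed. At most [2 * j * q] points are removed, so [w] always remain. *)
Lemma multicover K w q j :
    #|T| < K.+1 * w -> 0 < #|T| -> #|T| * #|T| * K ^ q < K.+1 ^ q ->
    (forall x y, w + 2 * j * q <= #|avail h g x y|) ->
  exists A, [/\ ends_closed g A, #|A| <= 2 * j * q &
    forall x y, j <= #|avail h g x y :&: A|].
Proof.
move=> ltTKw T_gt0 ltq; elim: j => [|j IH] av.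
  by exists set0; split=> // [x|]; rewrite ?inE ?cards0.
have [x y|A [Ag szA jA]] := IH.
  by apply: leq_trans (av x y); rewrite leq_add2l leq_mul2r leq_mul2l leqnSn !orbT.
pose S (i : T * T) := avail h g i.1 i.2 :\: A.
have leS i : w <= #|S i|.
  have := av i.1 i.2; rewrite -(cardsID A (avail h g i.1 i.2)) -/(S i).
  have : #|avail h g i.1 i.2 :&: A| <= 2 * j * q by apply: leq_trans szA;
    rewrite subset_leq_card ?subsetIr.
  by move: #|_| #|S i| => ??; clear; nia.
have := cover_exists ltTKw leS T_gt0; rewrite card_prod => /(_ _ ltq)[s szs Hs].
exists (A :|: [set x in mated s]); split.
- move=> x; rewrite !inE !mem_mated gK => /orP[/Ag->//|];
    by rewrite [_ || (_ \in s)]orbC => ->; rewrite orbT.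
- rewrite cardsU; have : #|[set x in mated s]| <= 2 * q.
    by rewrite cardsE -szs -size_mated card_size.
  by move: szA; clear; move: #|_| #|_| #|_| => ???; nia.
- move=> x y; have /hasP[a] := Hs (x, y); rewrite !inE /= => as_ /andP[aA aV].
  apply: (@leq_trans #|a |: (avail h g x y :&: A)|).
    by rewrite cardsU1 !inE (negPf aA) andbF add1n ltnS.
  apply/subset_leq_card/subsetP => b;
    rewrite !inE mem_mated => /orP[/eqP->|/andP[-> ->]//].
  by rewrite aV as_ orbT.
Qed.

(** The edges of a multiple cover are strung together by [link_chain]; choosing [t] as the first
    vertex closes the chain into a cycle. *)
Lemma reservoir K w q j :
    #|T| < K.+1 * w -> 0 < #|T| -> #|T| * #|T| * K ^ q < K.+1 ^ q ->
    0 < j -> (forall x y, w + 4 * j * q <= #|avail h g x y|) ->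
  exists R A, [/\ path.cycle e R /\ uniq R, size R <= 4 * j * q,
    forall x, x \in R -> g x \in R, forall a, a \in A -> linked g R a &
    forall x y, j <= #|avail h g x y :&: A|].
Proof.
move=> ltTKw T_gt0 ltq j_gt0 av.
have [x y|A [Ag szA jA]] := multicover (j := j) ltTKw T_gt0 ltq.
  by apply: leq_trans (av x y); clear; nia.
have [bs [ubs nbs] Abs] := mates_transversal Ag.
have umated := uniq_mated (conj ubs nbs).
have szbs : 2 * size bs = #|A|.
  by rewrite -size_mated -(card_uniqP umated); apply: eq_card => x; rewrite Abs.
have [t _] : exists t : T, t \in T by apply/card_gt0P.
have bs_neq0 : bs != [::].
  apply/eqP => bs0; have := jA t t; rewrite leqNgt => /negP; apply.
  have -> : A = set0 by apply/setP => x; rewrite Abs bs0 inE.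
  by rewrite setI0 cards0.
have [|v _|x|x y|s [[szs ohs] us sP lks ps]] := @link_chain bs set0 (head t bs).
- by split.
- by rewrite inE.
- by rewrite inE.
- rewrite cards0 add0n; apply: leq_trans (av x y).
  by move: szbs szA; clear; move: #|A| => ?; nia.
exists s, A; split.
- split=> //; case: bs bs_neq0 ohs ps {ubs nbs Abs umated szbs szs lks} => //= b bs _.
  case: s {us sP} => // _ s [->] ps.
  (* Some neighbour of [b] is needed as the start [u] in [ps]; it is dropped again. *)
  have : 0 < #|avail h g b b| by apply: leq_trans j_gt0 (leq_trans (jA b b) _);
    rewrite subset_leq_card ?subsetIl.
  case/card_gt0P=> a; rewrite inE hC => /andP[hab _].
  by have /= := ps a hab => /andP[].
- by rewrite szs; move: szbs szA; clear; move: #|A| => ?; nia.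
- by move=> x /sP/andP[].
- move=> a; rewrite Abs mem_mated => /orP[/lks//|/lks].
  by rewrite linked_mate.
- by [].
Qed.

End Reservoir.

(** * Alternating chains and the deterministic theorem *)

Section Selection.
Variable T : finType.
Implicit Types (qs : seq (seq T)) (sel : seq T -> T).

Lemma uniq_flatten_filter (P : pred (seq T)) qs :
  uniq (flatten qs) -> uniq (flatten [seq q <- qs | P q]).
Proof.
elim: qs => //= q qs IH; rewrite cat_uniq => /and3P[uq /hasPn H /IH u'].
case: (P q) => //=; rewrite cat_uniq uq u' andbT; apply/hasPn => v /flattenP[s].
by rewrite mem_filter => /andP[_ sqs] vs; apply: H; apply/flattenP; exists s.
Qed.

Lemma uniq_map_sel sel qs :
  uniq (flatten qs) -> (forall q, q \in qs -> sel q \in q) -> uniq (map sel qs).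
Proof.
elim: qs => //= q qs IH; rewrite cat_uniq => /and3P[uq /hasPn H /IH u'] selq.
rewrite u' ?andbT => [|s sqs]; last by apply: selq; rewrite inE sqs orbT.
apply/mapP => -[s sqs E]; have : sel s \in flatten qs.
  by apply/flattenP; exists s; rewrite // selq // inE sqs orbT.
by move/H; rewrite -E selq ?mem_head.
Qed.

Lemma leq_size_sel (A : {set T}) sel qs :
  uniq (map sel qs) -> (forall q, q \in qs -> sel q \in A) -> size qs <= #|A|.
Proof.
move=> u H; rewrite -(size_map sel) -(card_uniqP u); apply/subset_leq_card/subsetP.
by move=> x /mapP[q /H + ->].
Qed.

Lemma uniq_flatten_in qs q : uniq (flatten qs) -> q \in qs -> uniq q.
Proof.
elim: qs => //= s qs IH; rewrite cat_uniq => /and3P[us _ /IH u'].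
by rewrite inE => /orP[/eqP->|].
Qed.

Lemma size_split3 (P : pred (seq T)) L qs :
  size qs = size [seq q <- qs | P q && (size q <= L)]
    + size [seq q <- qs | P q && (L < size q)] + size [seq q <- qs | ~~ P q].
Proof.
elim: qs => //= q qs ->; case: (P q) => /=; last by rewrite addnS.
by case: leqP => _ /=; rewrite ?addSn // addnS addSn.
Qed.

End Selection.

Section Chains.
Variables (T : finType) (g m : T -> T).
Hypotheses (gK : involutive g) (gN : forall x, g x != x) (mK : involutive m).
Variable W : {set T}.
Hypotheses (Wm : forall x, x \in W -> m x \in W).
Implicit Types (x v : T) (q : seq T) (qs : seq (seq T)).
Let f v := m (g v).

(* A chain v_1, ..., v_l with v_(i+1) = m (g v_i) stands for the alternating path
   v_1, g v_1, v_2, g v_2, ..., v_l, g v_l. *)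
Definition chain_system qs :=
  [/\ independent_mates g (flatten qs),
      forall x, (x \in W) = (x \in mated g (flatten qs)) &
      forall q, q \in qs -> (q != [::]) && sorted (frel f) q].

Lemma chain_system_perm qs qs' :
  perm_eq qs qs' -> chain_system qs -> chain_system qs'.
Proof.
move=> pe [[u n] mW P]; have pf := perm_flatten pe; split.
- split=> [|v]; first by rewrite -(perm_uniq pf).
  by rewrite -!(perm_mem pf); apply: n.
- by move=> x; rewrite mW !mem_mated // !(perm_mem pf).
- by move=> q; rewrite -(perm_mem pe); apply: P.
Qed.

(** Read backwards, the alternating path visits [g v] before [v], so the representatives become the
    mates. *)
Definition rev_chain q := map g (rev q).

Lemma mem_rev_chain q x : (x \in rev_chain q) = (g x \in q).
Proof.
by rewrite -[x in LHS]gK (mem_map (can_inj gK)) mem_rev.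
Qed.

Lemma chain_system_rev q qs :
  chain_system (q :: qs) -> chain_system (rev_chain q :: qs).
Proof.
move=> [[u n] mW P]; rewrite /= in u n mW.
have uq : uniq q by move: u; rewrite cat_uniq => /and3P[].
have uqs : uniq (flatten qs) by move: u; rewrite cat_uniq => /and3P[].
have dj v : v \in q -> v \notin flatten qs.
  by move=> vq; move: u; rewrite cat_uniq => /and3P[_ /hasPn H _];
    apply: contraL vq => /H.
split.
- split=> [|v] /=.
    rewrite cat_uniq uqs andbT map_inj_uniq ?rev_uniq ?uq; last exact: can_inj.
    apply/hasPn => v vqs; rewrite mem_rev_chain; apply: contraL (vqs) => gvq.
    by have := n (g v); rewrite !mem_cat gvq gK negb_or => /(_ isT) /andP[].
  rewrite !mem_cat !mem_rev_chain gK negb_or.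
  case/orP=> [gvq|vqs]; last first.
    have := n v; rewrite !mem_cat vqs orbT negb_or => /(_ isT) /andP[_ ->].
    by rewrite andbT; apply: contraL vqs => /dj.
  by rewrite dj // andbT; have := n (g v);
    rewrite !mem_cat gvq gK negb_or => /(_ isT) /andP[].
- move=> x; rewrite mW !mem_mated //= !mem_cat !mem_rev_chain gK.
  by do 4! case: (_ \in _).
move=> s; rewrite inE => /orP[/eqP->|sqs]; last by apply: P; rewrite inE sqs orbT.
have /andP[q0 fq] := P q (mem_head _ _); apply/andP; split.
  by case: (q) q0 => // x q' _; rewrite /rev_chain rev_cons map_rcons; case: (map _ _).
rewrite sorted_map rev_sorted; apply: sub_sorted fq => x y /= /eqP<-.
by rewrite /f gK mK.
Qed.

Lemma chain_system_join x q y q' qs :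
    chain_system ((x :: q) :: (y :: q') :: qs) -> f (last x q) = y ->
  chain_system ((x :: q ++ y :: q') :: qs).
Proof.
move=> [I mW P] fy; split.
- by rewrite /= -catA.
- by move=> z; rewrite mW /= -catA.
move=> s; rewrite inE => /orP[/eqP->|sqs]; last by apply: P; rewrite !inE sqs !orbT.
have /= pq := P _ (mem_head _ _).
have /= pq' : path (frel f) y q' by apply: (P (y :: q')); rewrite !inE eqxx orbT.
by rewrite /= cat_path pq /= fy eqxx.
Qed.

(** Let [w] be the successor of the last vertex [v]. If [w] occurs in a chain, it is the head of
    another one, since its predecessor could only be [v]; the two are joined. If [g w] occurs, it is
    the end of another chain, since its successor would be [g v]; that chain is reversed and
    joined. *)
Lemma chain_tail x q qs :
    chain_system ((x :: q) :: qs) ->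
    f (last x q) != x -> f (last x q) != g (last x q) ->
  exists2 qs', chain_system qs' & size qs' <= size qs.
Proof.
set v := last x q => sys; case: (sys) => [[u n] mW P] fx fgv.
set w := f v in fx fgv *; set F := flatten _ in u n mW.
have EF : F = (x :: q) ++ flatten qs by [].
have vF : v \in F by rewrite EF mem_cat /v mem_last.
have wW : w \in W by apply: Wm; rewrite mW mem_mated // gK vF orbT.
have uxq : uniq (x :: q) by move: u; rewrite EF cat_uniq => /andP[].
have other q' : q' \in (x :: q) :: qs -> q' != x :: q ->
    exists qs', perm_eq ((x :: q) :: qs) [:: x :: q, q' & qs'].
  rewrite inE => /orP[->//|q'qs] _; exists (rem q' qs).
  by rewrite perm_cons perm_to_rem.
have vother q' : q' \in (x :: q) :: qs -> q' != x :: q -> v \notin q'.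
  rewrite inE => /orP[->//|q'qs] _.
  move: u; rewrite EF cat_uniq => /and3P[_ /hasPn H _].
  apply/negP => vq'; have : v \in flatten qs by apply/flattenP; exists q'.
  by move/H; rewrite /v mem_last.
have := wW; rewrite mW mem_mated // => /orP[/flattenP[q' q'S wq']|/flattenP[q' q'S
  wq']].
  have /andP[_ fq'] := P q' q'S.
  case/splitPr: wq' q'S fq' => l r q'S fq'.
  case/lastP: l q'S fq' => [|l z] q'S fq'.
    have [E|ne] := eqVneq (w :: r) (x :: q).
      by case: E fx => -> _; rewrite eqxx.
    have [qs' pe] := other _ q'S ne.
    exists ((x :: q ++ w :: r) :: qs').
      by apply: chain_system_join => //; apply: chain_system_perm pe sys.
    by have := perm_size pe => /= [[->]].
  have Ez : z = v.
    move: fq'; rewrite cat_rcons sorted_cat_cons_path => /andP[_ /= /andP[/eqP H _]].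
    by apply/(can_inj gK)/(can_inj mK); rewrite -/(f z) -/(f v) H.
  rewrite Ez in q'S fq'.
  have [E|ne] := eqVneq (rcons l v ++ w :: r) (x :: q); last first.
    by have := vother _ q'S ne; rewrite mem_cat mem_rcons mem_head.
  exfalso; move: uxq; rewrite -E cat_uniq => /and3P[_ /hasPn H _].
  have : v \in w :: r.
    have -> : v = last x (x :: q) by [].
    by rewrite -E last_cat /= mem_last.
  by move/H; rewrite mem_rcons mem_head.
have /andP[_ fq'] := P q' q'S.
case/splitPr: wq' q'S fq' => l r q'S fq'; case: r q'S fq' => [|z r] q'S fq'.
  have [E|ne] := eqVneq (l ++ [:: g w]) (x :: q).
    have : last x (x :: q) = g w by rewrite -E last_cat.
    by rewrite /= -/v => Ev; rewrite Ev gK eqxx in fgv.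
  have [qs' pe] := other _ q'S ne.
  have E2 : rev_chain (l ++ [:: g w]) = w :: rev_chain l.
    by rewrite /rev_chain rev_cat /= gK.
  exists ((x :: q ++ w :: rev_chain l) :: qs').
    apply: chain_system_join => //; rewrite -E2.
    apply: (@chain_system_perm [:: rev_chain (l ++ [:: g w]), x :: q & qs']).
      by rewrite -[_ :: _]/([:: _] ++ [:: _] ++ qs') -[X in perm_eq _ X]/([:: _] ++
        [:: _] ++ qs') perm_catCA.
    apply: chain_system_rev; apply: chain_system_perm sys.
    apply: perm_trans pe _.
    by rewrite -[_ :: _]/([:: _] ++ [:: _] ++ qs') -[X in perm_eq _ X]/([:: _] ++ [::
      _] ++ qs') perm_catCA.
  by have := perm_size pe => /= [[->]].
exfalso; move: fq'; rewrite sorted_cat_cons_path => /andP[_ /= /andP[/eqP H _]].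
have zF : z \in F by apply/flattenP; exists (l ++ [:: g w, z & r]);
  rewrite // mem_cat !inE eqxx !orbT.
by have := n v vF; rewrite -[g v]mK -/(f v) -/w -[w]gK -/(f _) H zF.
Qed.

(** Either the alternating path closes up through [m], or [m] fixes both of its ends. *)
Definition saturated q :=
  if q is x :: q' then
    (f (last x q') == x) || (m x == x) && (f (last x q') == g (last x q'))
  else true.

Lemma chain_improve q qs : chain_system (q :: qs) -> ~~ saturated q ->
  exists2 qs', chain_system qs' & size qs' <= size qs.
Proof.
case: q => // x q sys /=; rewrite negb_or negb_and => /andP[fx /orP[mx|]];
  last exact: chain_tail.
have E : rev_chain (x :: q) = g (last x q) :: rev_chain (belast x q).
  by rewrite /rev_chain lastI rev_rcons.
have := chain_system_rev sys; rewrite E => /chain_tail; apply.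
  rewrite (_ : last _ _ = g x); last first.
    by case: (q) => //= y q'; rewrite /rev_chain rev_cons map_rcons last_rcons.
  rewrite /f gK; apply: contra fx => /eqP H.
  by rewrite /f -H mK.
rewrite (_ : last _ _ = g x); last first.
  by case: (q) => //= y q'; rewrite /rev_chain rev_cons map_rcons last_rcons.
by rewrite /f gK.
Qed.

(** Starting from single edges, every unsaturated chain allows a join, which lowers the number of
    chains. *)
Lemma chain_saturated : ends_closed g W ->
  exists2 qs, chain_system qs & all saturated qs.
Proof.
move=> Wg; have [bs I Wbs] := mates_transversal gK gN Wg.
have : chain_system [seq [:: b] | b <- bs].
  have E : flatten [seq [:: b] | b <- bs] = bs by elim: (bs) => //= b s ->.
  by split; rewrite ?E // => q /mapP[b _ ->].
move: (map _ bs) => qs; move: {2}(size qs) (leqnn (size qs)) => k.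
elim: k qs => [|k IH] qs szk sys.
  by move: szk sys; rewrite leqn0 size_eq0 => /eqP-> sys; exists [::].
have [sat|/allPn[q qqs nsat]] := boolP (all saturated qs); first by exists qs.
have pe := perm_to_rem qqs.
have [qs' sys' sz'] := chain_improve (chain_system_perm pe sys) nsat.
apply: (IH qs') => //; apply: leq_trans sz' _.
by move: szk; rewrite (perm_size pe).
Qed.

(** A closed orbit of the composite of [m] and [g] that meets each matching edge at most once, that
    is, an alternating cycle with [l] edges of [g]. *)
Definition loop l v :=
  let q := traject f v l in
  [&& uniq q, all (fun u => g u \notin q) q & iter l f v == v].

(** Closed chains of length at most [L] have their heads in [B]; longer closed chains are disjoint,
    hence at most [#|T| %/ L.+1]; each open chain accounts for two fixed points of [m]. *)
Lemma size_chains L (B : {set T}) qs :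
    chain_system qs -> all saturated qs ->
    (forall v l, 0 < l <= L -> v \in W -> loop l v -> v \in B) ->
  2 * size qs <= #|[set x in W | m x == x]| + 2 * #|B| + 2 * (#|T| %/ L.+1).
Proof.
move=> [[u n] mW P] sat HB.
have [T0|/card_gt0P[x0 _]] := posnP #|T|.
  case: qs u {n mW sat} P => // q qs _ P.
  have /andP[+ _] := P q (mem_head _ _).
  by case: (q) => // x; have := fintype0 x T0.
pose tail q := g (last x0 q); pose closed q := m (tail q) == head x0 q.
set F := flatten qs in u n mW.
have nzP q : q \in qs -> (head x0 q \in q) && (last x0 q \in q).
  by case: q => [/P//|x q] _; rewrite mem_head /= mem_last.
have FP q v : q \in qs -> v \in q -> v \in F by move=> qqs vq; apply/flattenP; exists q.
pose qA := [seq q <- qs | closed q && (size q <= L)].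
pose qB := [seq q <- qs | closed q && (L < size q)].
pose qC := [seq q <- qs | ~~ closed q].
have szq : size qs = size qA + size qB + size qC by apply: size_split3.
have szA : size qA <= #|B|.
  apply: (@leq_size_sel _ _ (head x0)).
    apply: uniq_map_sel; first exact: uniq_flatten_filter.
    by move=> q; rewrite mem_filter => /andP[_ /nzP/andP[]].
  move=> q; rewrite mem_filter => /andP[/andP[cl szL] qqs].
  case: q cl szL qqs => [|x q] cl szL qqs; first by have := P _ qqs.
  have /= fq := P _ qqs.
  have Eq : x :: q = traject f x (size q).+1.
    by rewrite {1}(fpathE fq).
  apply: (HB x (size q).+1); rewrite ?szL //.
    by rewrite mW mem_mated // (FP _ _ qqs) ?mem_head.
  apply/and3P; rewrite -Eq; split.
  - exact: (uniq_flatten_in u).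
  - by apply/allP => v vq; apply: contra (n v (FP _ _ qqs vq)); apply: FP.
  - have El : last x q = iter (size q) f x by rewrite {1}(fpathE fq) last_traject.
    by rewrite iterS -El.
have szB : size qB <= #|T| %/ L.+1.
  rewrite leq_divRL //; apply: (@leq_trans (size (flatten qB))).
    by apply: leq_size_flatten => q; rewrite mem_filter => /andP[/andP[]].
  by rewrite -(card_uniqP (uniq_flatten_filter _ u)) max_card.
have szC : 2 * size qC <= #|[set x in W | m x == x]|.
  have qCP q : q \in qC -> (m (head x0 q) == head x0 q) && (m (tail q) == tail q).
    rewrite mem_filter => /andP[ncl qqs]; have := allP sat q qqs.
    case: q ncl qqs => [|x q] ncl qqs; first by have := P _ qqs.
    by move: ncl; rewrite /closed /tail /= => /negPf; rewrite /f => ->.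
  pose hs := [set x in map (head x0) qC]; pose ts := [set x in map tail qC].
  have uh : uniq (map (head x0) qC).
    apply: uniq_map_sel; first exact: uniq_flatten_filter.
    by move=> q; rewrite mem_filter => /andP[_ /nzP/andP[]].
  have ut : uniq (map tail qC).
    rewrite (map_comp g) map_inj_uniq; last exact: can_inj.
    apply: uniq_map_sel; first exact: uniq_flatten_filter.
    by move=> q; rewrite mem_filter => /andP[_ /nzP/andP[]].
  have sub : hs :|: ts \subset [set x in W | m x == x].
    apply/subsetP => x; rewrite !inE => /orP[] /mapP[q qC_ ->];
      have /andP[mh mt] := qCP q qC_; move: qC_; rewrite mem_filter => /andP[_ qqs];
      have /andP[hq lq] := nzP q qqs.
      by rewrite mh andbT mW mem_mated // (FP q).
    by rewrite mt andbT mW mem_mated // /tail gK (FP q _ qqs lq) orbT.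
  (* Heads are representatives and tails are mates of representatives. *)
  have dis : hs :&: ts = set0.
    apply/setP => x; rewrite !inE;
      apply/negbTE/negP => /andP[/mapP[q + ->] /mapP[q' + E]].
    rewrite !mem_filter => /andP[_ qqs] /andP[_ q'qs].
    have /andP[hq _] := nzP q qqs; have /andP[_ lq] := nzP q' q'qs.
    by have := n _ (FP _ _ q'qs lq); rewrite -/(tail q') -E (FP q).
  apply: leq_trans (subset_leq_card sub); rewrite cardsU dis cards0 subn0 !cardsE.
  by rewrite (card_uniqP uh) (card_uniqP ut) !size_map mul2n addnn.
by move: szA szB szC; rewrite szq; clear; move: (size qA) (size qB) (size qC) => ???;
  lia.
Qed.

End Chains.

(** * Cycles of all lengths for a fixed matching *)

Section Deterministic.
Variables (T : finType) (h : rel T) (g m : T -> T).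
Hypotheses (hC : symmetric h) (gK : involutive g) (gN : forall x, g x != x).
Hypotheses (mK : involutive m) (mh : forall x, m x != x -> h x (m x)).
Local Notation e := (union_adj h g).

Section Restriction.
Variable W : {set T}.

(** Pairs of [m] that leave [W] are dissolved into fixed points, which keeps an involution. *)
Definition restrict_match x := if (x \in W) && (m x \in W) then m x else x.

Lemma restrict_matchK : involutive restrict_match.
Proof.
move=> x; rewrite /restrict_match; case: (boolP ((x \in W) && (m x \in W))) => H;
  last by rewrite (negPf H).
by rewrite mK andbC H.
Qed.

Lemma restrict_match_stable x : x \in W -> restrict_match x \in W.
Proof. by rewrite /restrict_match => xW; case: ifP => // /andP[]. Qed.

Lemma restrict_matchE x : restrict_match x != x -> restrict_match x = m x.
Proof. by rewrite /restrict_match; case: ifP; rewrite ?eqxx. Qed.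

(** A vertex [g u] with [u] on the loop is never fixed by the restriction, since otherwise the loop
    would contain both [u] and its mate. *)
Lemma loop_restrict l v : 0 < l -> loop g restrict_match l v -> loop g m l v.
Proof.
set f' := fun v => restrict_match (g v); set f := fun v => m (g v) => l_gt0.
case/and3P=> uq /allP nq /eqP fl.
have mem i : i <= l -> iter i f' v \in traject f' v l.
  rewrite leq_eqVlt => /orP[/eqP->|lt]; last by apply/trajectP; exists i.
  by rewrite fl; apply/trajectP; exists 0.
have it i : i <= l -> iter i f v = iter i f' v.
  elim: i => // i IH lt; rewrite !iterS IH ?(ltnW lt) // /f -restrict_matchE //.
  have := nq _ (mem i (ltnW lt)); apply: contraNneq => E.
  by rewrite /= -[g _]E -[restrict_match _]/(iter i.+1 f' v) mem.
have tr : traject f v l = traject f' v l.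
  apply: (@eq_from_nth _ v); rewrite !size_traject // => i lt.
  by rewrite !nth_traject // it // ltnW.
by apply/and3P; rewrite -/f tr it // fl; split=> //; apply/allP.
Qed.

End Restriction.

Lemma path_mated f0 x q : (forall v, f0 v != v -> h v (f0 v)) ->
    path (frel (fun v => f0 (g v))) x q -> (forall v, v \in x :: q -> g v \notin x ::
      q) ->
  path e x (g x :: mated g q).
Proof.
move=> fh; elim: q x => [|y q IH] x /=; first by rewrite union_adjG.
case/andP=> /eqP fx pq nq; rewrite union_adjG.
have -> : e (g x) y.
  apply: union_adjH; rewrite -fx; apply: fh; rewrite fx.
  by have := nq x; rewrite !inE eqxx !negb_or => /(_ isT) /and3P[_ + _]; rewrite eq_sym.
apply: IH => // v vq; have := nq v; rewrite inE vq orbT => /(_ isT).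
by rewrite inE negb_or => /andP[].
Qed.

Lemma linked_mated q a : a \in mated g q -> linked g (mated g q) a.
Proof.
elim: q => //= v q IH; rewrite inE => /orP[/eqP->|]; first by rewrite /linked /= !eqxx.
rewrite inE => /orP[/eqP->|/IH /orP[] H]; first by rewrite /linked /= gK !eqxx orbT.
  by rewrite /linked /= H !orbT.
by rewrite /linked /= H !orbT.
Qed.

Lemma chains_tiling f0 W qs : (forall v, f0 v != v -> h v (f0 v)) ->
  chain_system g f0 W qs -> tiling h g W set0 [seq mated g q | q <- qs].
Proof.
move=> fh [[u n] mW P].
have E : flatten [seq mated g q | q <- qs] = mated g (flatten qs).
  by rewrite /mated map_flatten; elim: (qs) => //= q s ->; rewrite flatten_cat.
split; rewrite ?E.
- exact: uniq_mated.
- by move=> x; rewrite mW.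
- move=> s /mapP[q qqs ->]; have := P q qqs; case: q qqs => // x q qqs /= pq.
  rewrite andbT; apply: (path_mated fh) => // v vq.
  have vF : v \in flatten qs by apply/flattenP; exists (x :: q).
  by apply: contra (n v vF) => H; apply/flattenP; exists (x :: q).
move=> a; rewrite mW mem_mated // => + _; case/orP=> /flattenP[q qqs aq];
  exists (mated g q); rewrite ?map_f //; apply: linked_mated;
    rewrite mem_mated // aq ?orbT //.
Qed.

(** A path on [k - 2] vertices is grown greedily through [h] and closed by a fresh matching edge
    [a, g a]. *)
Lemma short_cycle z k : (forall x y, z <= #|avail h g x y|) -> 0 < #|T| ->
  3 <= k -> 2 * k <= z -> exists c, [/\ path.cycle e c, uniq c & size c = k].
Proof.
move=> av /card_gt0P[x0 _]; case: k => [|[|[|j]]] // _ lez.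
have fresh x y s : 2 * size s < z -> exists a, [/\ h x a, h (g a) y, a \notin s & g a
  \notin s].
  move=> lts; have /subsetPn[a] : ~~ (avail h g x y \subset [set v in mated g s]).
    apply/negP => /subset_leq_card; rewrite leqNgt => /negP; apply.
    by apply: leq_trans (av x y);
      rewrite cardsE (leq_ltn_trans (card_size _)) ?size_mated.
  by rewrite !inE mem_mated // negb_or => /andP[? ?] /andP[? ?]; exists a.
have [x [p [szp pp up]]] : exists x p, [/\ size p = j, path e x p & uniq (x :: p)].
  elim: j lez => [|j IH] lez; first by exists x0, [::].
  have [|x [p [szp pp up]]] := IH; first by apply: leq_trans lez;
    rewrite leq_mul2l leqnSn.
  have [|a [hxa _ ap _]] := fresh x x (x :: p).
    by apply: leq_trans lez; rewrite /= szp; clear; lia.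
  exists a, (x :: p); rewrite /= szp pp /= (union_adjH _ _) 1?hC //; split=> //.
  by rewrite -cons_uniq cons_uniq ap.
have [|a [hya hax ap gap]] := fresh (last x p) x (x :: p).
  by apply: leq_trans lez; rewrite /= szp; clear; lia.
exists (x :: p ++ [:: a; g a]); split.
- by rewrite /= rcons_cat cat_path pp /= (union_adjH _ hya) union_adjG (union_adjH _
    hax).
- rewrite -cat_cons cat_uniq up [has _ _]/= orbF negb_or ap gap /=.
  by rewrite mem_seq1 eq_sym gN.
- by rewrite /= size_cat szp addn2.
Qed.

(** At most [K] pieces have to be absorbed at two points each, so the reservoir is taken with
    [j = 2 * K] and has at most [8 * K * q] vertices. It is paid for twice: once for the insertion
    points lost in it, once for the vertices whose partner under [m] lies in it. *)
Theorem all_cycle_lengths K w q L (B : {set T}) :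
    0 < #|T| -> 0 < K -> #|T| < K.+1 * w -> #|T| * #|T| * K ^ q < K.+1 ^ q ->
    (forall v l, 0 < l <= L -> loop g m l v -> v \in B) ->
    (forall x y, w + 16 * K * q + #|[set x | m x == x]| + 2 * #|B|
      + 2 * (#|T| %/ L.+1) <= #|avail h g x y|) ->
  forall k, 3 <= k <= #|T| -> exists c, [/\ path.cycle e c, uniq c & size c = k].
Proof.
move=> T_gt0 K_gt0 ltTKw ltq HB av k /andP[k3 kT].
have [|x y|R [A [[cR uR] szR Rg lkA jA]]] := @reservoir T h g hC gK gN K w q (2 * K)
  ltTKw T_gt0 ltq.
- by rewrite muln_gt0.
- apply: leq_trans (av x y); rewrite -!addnA leq_add2l; apply: leq_trans (leq_addr _ _).
  by rewrite mulnA !leq_mul2r !orbT.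
have szR' : size R <= 8 * (K * q) by rewrite mulnA; move: szR; rewrite mulnA.
have [ltkR|leRk] := ltnP k (size R).
  apply: (@short_cycle (16 * K * q)) => //.
    move=> x y; apply: leq_trans (av x y); rewrite -!addnA.
    by apply: leq_trans (leq_addl _ _); rewrite leq_addr.
  by rewrite -mulnA; move: szR' ltkR; clear; move: (K * q) (size R) => ??; lia.
pose W := ~: [set x in R].
have Wg : ends_closed g W.
  by move=> x; rewrite !inE; apply: contra => /Rg; rewrite gK.
have [qs sys sat] := chain_saturated gK gN (@restrict_matchK W)
  (@restrict_match_stable W) Wg.
have szqs : 2 * size qs <= #|[set x | m x == x]| + size R + 2 * #|B| + 2 * (#|T| %/
  L.+1).
  apply: leq_trans (size_chains gK sys sat (B := B) (L := L) _) _.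
    by move=> v l lL _ /loop_restrict H; apply: (HB v l) => //; apply: H; case/andP: lL.
  (* A fixed point of the restriction is fixed by [m] or mapped into [R] by [m]. *)
  rewrite !leq_add2r; apply: (@leq_trans #|[set x | m x == x] :|: [set x | m x \in R]|).
    apply/subset_leq_card/subsetP => x;
      rewrite !inE /restrict_match !inE => /andP[->] /=.
    by case: (m x \in R); rewrite ?orbT // orbF.
  rewrite cardsU; apply: leq_trans (leq_subr _ _) _; rewrite leq_add2l.
  rewrite -(card_imset _ (can_inj mK)) cardE uniq_leq_size ?enum_uniq // => x.
  by rewrite mem_enum => /imsetP[y]; rewrite inE => myR ->.
have fh v : restrict_match W v != v -> h v (restrict_match W v).
  by move=> H; rewrite restrict_matchE //; apply: mh; rewrite -(restrict_matchE H).
have til := chains_tiling fh sys.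
have [x y|ss' [D [[uss fW sP _] szss]]] := tiling_coarsen hC gK til ltTKw.
  rewrite cards0 addn0 size_map.
  have : #|avail h g x y| <= #|avail h g x y :&: W| + size R.
    rewrite -(cardsID W (avail h g x y)) leq_add2l.
    apply: (@leq_trans #|[set x in R]|); last by rewrite cardsE card_size.
    by apply/subset_leq_card/subsetP => v; rewrite !inE negbK => /andP[].
  have := av x y; rewrite -mulnA; move: szqs szR'; clear.
  move: #|avail h g x y| #|_ :&: _| #|B| #|[set x | _]| (_ %/ _) (size qs) (size R) (K
    * q).
  by move=> ????????; lia.
have uRss : uniq (R ++ flatten ss').
  rewrite cat_uniq uR uss andbT; apply/hasPn => v.
  by rewrite fW !inE.
apply: (absorb_pieces hC gK cR uRss (A := A)) => //.
- by apply/allP => s /sP/andP[].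
- by move=> x y; apply: leq_trans (jA x y); rewrite leq_mul2l szss.
- rewrite leRk -size_cat -(card_uniqP uRss); apply: leq_trans kT _.
  by apply/subset_leq_card/subsetP => v _; rewrite mem_cat fW !inE orbN.
Qed.

End Deterministic.

(** * Switchings of pairings and maximum matchings *)

Section Pairings.
Variable T : finType.
Implicit Types (g : {perm T}) (a b x y : T).

Definition pairings : {set {perm T}} :=
  [set g : {perm T} | [forall x, (g (g x) == x) && (g x != x)]].

Lemma pairingP g :
  reflect (involutive g /\ forall x, g x != x) (g \in pairings).
Proof.
rewrite inE; apply: (iffP forallP) => [H|[gK gN] x]; last by rewrite gK eqxx gN.
by split=> x; have /andP[/eqP] := H x.
Qed.

Lemma conj_tpermE g a b x : (g ^ tperm a b)%g x = tperm a b (g (tperm a b x)).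
Proof. by rewrite conjgE tpermV !permM. Qed.

Lemma conj_tpermK g a b : ((g ^ tperm a b) ^ tperm a b)%g = g.
Proof. by rewrite -conjgM tperm2 conjg1. Qed.

Lemma pairing_conj g a b : g \in pairings -> (g ^ tperm a b)%g \in pairings.
Proof.
case/pairingP=> gK gN; apply/pairingP; split=> x; rewrite !conj_tpermE.
  by rewrite tpermK gK tpermK.
by rewrite -[X in _ != X](tpermK a b x) (inj_eq perm_inj) gN.
Qed.

(* A pairing with a closed walk of length l through v is switched to one
   without it by exchanging the last edge with an edge off the walk; the
   walk, and hence the original pairing, can be read off the result. *)
Lemma loop_count (m : T -> T) v l : involutive m -> 0 < l ->
  #|[set g in pairings | loop g m l v]| * (#|T| - 2 * l) <= #|pairings|.
Proof.
move=> mK; case: l => // l _; set bad := [set _ in _ | _].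
pose f (g : {perm T}) z := m (g z).
pose C (g : {perm T}) := ~: [set c in mated g (traject (f g) v l.+1)].
pose P := [set gc : {perm T} * T | (gc.1 \in bad) && (gc.2 \in C gc.1)].
pose switch (gc : {perm T} * T) := (gc.1 ^ tperm (iter l (f gc.1) v) gc.2)%g.
(* The loop closes, so its last vertex is paired with [m v]; after the switch the mate of [m v] is
   the exchanged point, and the earlier steps of the walk are unchanged. *)
pose unswitch (g : {perm T}) := ((g ^ tperm (iter l (f g) v) (g (m v)))%g, g (m v)).
have leP : #|bad| * (#|T| - 2 * l.+1) <= #|P|.
  rewrite -sum_nat_const (@leq_trans (\sum_(g in bad) #|C g|)) //.
    apply: leq_sum => g _; rewrite cardsCs setCK leq_sub2l // cardsE.
    by apply: leq_trans (card_size _) _; rewrite size_mated size_traject.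
  rewrite -[#|P|]sum1_card (eq_bigr (fun g => \sum_(c in C g) 1)) => [|g _];
    last by rewrite sum1_card.
  by rewrite pair_big_dep /= leq_eqVlt; apply/orP; left; apply/eqP;
    apply: eq_bigl => gc; rewrite !inE.
have swK : {in P, cancel switch unswitch}.
  case=> g c; rewrite in_set => /andP[gbad cC].
  have {gbad} : g \in bad := gbad; have {cC} : c \in C g := cC.
  rewrite [g \in bad]in_set => + /andP[/pairingP[gK gN] /and3P[uq /allP nq /eqP fl]];
    rewrite in_setC in_set mem_mated // negb_or => /andP[cq gcq].
  pose q := traject (f g) v l.+1; rewrite -/q in cq gcq.
  have {}uq : uniq q := uq.
  have {}nq u : u \in q -> g u \notin q := nq u.
  have qi i : i <= l -> iter i (f g) v \in q by move=> li; apply/trajectP; exists i.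
  set p := iter l (f g) v; have pq : p \in q by apply: qi.
  rewrite /switch /= -/p; set g' := (g ^ tperm p c)%g.
  have Egp : g p = m v by rewrite -[g p]mK -[m (g p)]/(iter l.+1 (f g) v) fl.
  have Ec : g' (m v) = c.
    have n1 : p != g p by rewrite eq_sym gN.
    have n2 : c != g p by apply: contraNneq gcq => ->; rewrite gK.
    by rewrite -Egp /g' conj_tpermE [tperm p c (g p)]tpermD // gK tpermL.
  have Ei i : i <= l -> iter i (f g') v = iter i (f g) v.
    elim: i => // i IH li; rewrite !iterS IH ?(ltnW li) // /f; congr (m _).
    set z := iter i _ v; have zq : z \in q by apply/qi/ltnW.
    have gzq : g z \notin q by apply: nq.
    rewrite /g' conj_tpermE [tperm p c z]tpermD ?tpermD //.
    - by apply: contraNneq gzq => <-.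
    - by apply: contraNneq gcq => ->; rewrite gK.
    - have := nth_uniq v (i := l) (j := i) _ _ uq.
      rewrite size_traject !nth_traject ?ltnS ?(ltnW li) // => -> //.
      by rewrite eqn_leq leqNgt li.
    - by apply: contraNneq cq => ->.
  by rewrite /unswitch Ei // -/p Ec conj_tpermK.
apply: leq_trans leP _; rewrite -(card_in_imset (can_in_inj swK)).
apply/subset_leq_card/subsetP => _ /imsetP[[g c] + ->].
by rewrite !inE /= => /andP[/andP[gI _] _];
  have := @pairing_conj g (iter l (f g) v) c; rewrite !inE; apply.
Qed.

Lemma pairing_value_count a b b' : a != b -> a != b' ->
  #|[set g in pairings | g a == b]| <= #|[set g in pairings | g a == b']|.
Proof.
move=> ab ab'; rewrite -(card_imset _ (@conjg_inj _ (tperm b b'))).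
apply/subset_leq_card/subsetP => _ /imsetP[g + ->];
  rewrite in_set => /andP[gI /eqP gab].
rewrite /= in_set pairing_conj //= conj_tpermE.
by rewrite [tperm b b' a]tpermD 1?eq_sym // gab tpermL.
Qed.

(** By [pairing_value_count] the mate of [a] is uniform on the other points. *)
Lemma pairing_value_prob a b : a != b ->
  #|T|.-1 * #|[set g in pairings | g a == b]| = #|pairings|.
Proof.
move=> ab; rewrite -[RHS]sum1_card (partition_big (fun g : {perm T} => g a) (fun c =>
  c != a)) /=.
  rewrite -(cardC1 a) -sum_nat_const; apply: eq_big => [c|c]; first by rewrite !inE.
  rewrite !inE eq_sym => ac; rewrite sum1dep_card; apply/eqP.
  rewrite eqn_leq; apply/andP; split.
    apply: leq_trans (pairing_value_count ab ac) _; apply: subset_leq_card.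
    by apply/subsetP => g; rewrite !inE.
  apply: leq_trans (pairing_value_count ac ab); apply: subset_leq_card.
  by apply/subsetP => g; rewrite !inE.
by move=> g /pairingP[_ gN].
Qed.

Variable h : rel T.
Hypothesis hC : symmetric h.

(** Linearity of expectation over pairs of a neighbour [a] of [x] and a neighbour [b] of [y]. Pairs
    with [a = b] contribute nothing, which turns one factor [d] into [d.-1]. *)
Lemma avail_mean d x y :
    d <= #|[set z | h x z]| -> d <= #|[set z | h y z]| ->
  d * d.-1 * #|pairings| <= #|T|.-1 * \sum_(g in pairings) #|avail h g x y|.
Proof.
move=> dx dy.
have -> : \sum_(g in pairings) #|avail h g x y| =
    \sum_(a | h x a) \sum_(b | h y b) #|[set g in pairings | g a == b]|.
  transitivity (\sum_(g in pairings) \sum_(a | h x a) \sum_(b | h y b) (g a == b)).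
    apply: eq_bigr => g _; rewrite -sum1_card big_mkcond /= [RHS]big_mkcond /=.
    apply: eq_bigr => a _; rewrite inE; case: (h x a) => //=.
    case: ifP => hy.
      rewrite (bigD1 (g a)) ?eqxx /=; last by rewrite hC.
      by rewrite big1 // => b /andP[_]; rewrite eq_sym => /negPf->.
    by rewrite big1 // => b hb; case: eqP => // E; rewrite E hC hb in hy.
  rewrite exchange_big /=; apply: eq_bigr => a _; rewrite exchange_big /=.
  apply: eq_bigr => b _; rewrite -sum1_card big_mkcond [RHS]big_mkcond /=.
  by apply: eq_bigr => g _; rewrite !inE; case: ([forall _, _]); case: (_ == b).
rewrite big_distrr /= (@leq_trans (\sum_(a in [set z | h x z]) d.-1 * #|pairings|)) //.
  by rewrite sum_nat_const -mulnA leq_mul2r dx orbT.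
rewrite (eq_bigl (fun a => h x a)) => [|a]; last by rewrite inE.
apply: leq_sum => a hxa; rewrite big_distrr /=.
apply: (@leq_trans (\sum_(b in [set z | h y z] :\ a) #|pairings|)).
  rewrite sum_nat_const leq_mul2r; apply/orP; right.
  have := dy; rewrite (cardsD1 a); case: (a \in _) => /=; last by clear;
    case: d => //= d /ltnW.
  by rewrite add1n; clear; case: d.
rewrite [leqRHS](bigID (fun b => b != a)) /= -[leqLHS]addn0 leq_add //.
rewrite leq_eqVlt; apply/orP; left; apply/eqP; apply: eq_big => [b|b].
  by rewrite !inE andbC.
by rewrite !inE eq_sym => /andP[ab _]; rewrite pairing_value_prob.
Qed.

(** Conjugation affects only points [a] for which [a] or [g a] is one of [w], [w'], and there are at
    most four. *)
Lemma avail_switch_sub g w w' x y : 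
  #|avail h g x y| <= #|avail h (g ^ tperm w w')%g x y| + 4.
Proof.
set g' := (g ^ _)%g.
pose X := [set w; w'] :|: [set z | g z == w] :|: [set z | g z == w'].
have cX : #|X| <= 4.
  have c1 u : #|[set z | g z == u]| <= 1.
    apply/card_le1_eqP => z z'; rewrite !inE => /eqP E /eqP E'.
    by apply: (@perm_inj _ g); rewrite E E'.
  rewrite /X; apply: leq_trans (leq_card_setU _ _) _.
  apply: leq_trans (leq_add (leq_card_setU _ _) (c1 _)) _.
  by rewrite -[4]/(2 + 1 + 1) leq_add2r leq_add // cards2; case: (_ != _).
apply: (@leq_trans #|avail h g' x y :|: X|);
  last by apply: leq_trans (leq_card_setU _ _) _; rewrite leq_add2l.
apply/subset_leq_card/subsetP => a; rewrite !inE => /andP[hxa hay].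
have [->|aw] := eqVneq a w; first by rewrite !orbT.
have [->|aw'] := eqVneq a w'; first by rewrite !orbT.
have [gw|gw] := eqVneq (g a) w; first by rewrite !orbT.
have [gw'|gw'] := eqVneq (g a) w'; first by rewrite !orbT.
by rewrite hxa /g' conj_tpermE [tperm w w' a]tpermD 1?eq_sym // tpermD 1?eq_sym // hay.
Qed.

End Pairings.

(** * Maximum matchings under a minimum degree condition *)

Section Matching.
Variables (T : finType) (h : rel T) (d : nat).
Hypotheses (hC : symmetric h) (hN : forall x, ~~ h x x).
Hypothesis degh : forall x, d <= #|[set y | h x y]|.
Implicit Types (m : {perm T}).

Definition partial_matchings : {set {perm T}} :=
  [set m : {perm T} | [forall x, (m (m x) == x) && ((m x != x) ==> h x (m x))]].

Definition unmatched m := [set x | m x == x].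

Lemma partial_matchingP m : reflect (involutive m /\ forall x, m x != x -> h x (m x))
  (m \in partial_matchings).
Proof.
rewrite inE; apply: (iffP forallP) => [H|[mK mh] x].
  by split=> x; have /andP[/eqP ? /implyP] := H x.
by rewrite mK eqxx; apply/implyP/mh.
Qed.

Lemma match_pair m a b : m \in partial_matchings -> h a b -> m a = a -> m b = b ->
  (m * tperm a b)%g \in partial_matchings /\
  unmatched (m * tperm a b)%g = unmatched m :\ a :\ b.
Proof.
move=> /partial_matchingP[mK mh] hab ma mb.
have ab : a != b by apply: contraTneq hab => ->.
have Ea : (m * tperm a b)%g a = b by rewrite permM ma tpermL.
have Eb : (m * tperm a b)%g b = a by rewrite permM mb tpermR.
have Ez z : z != a -> z != b -> (m * tperm a b)%g z = m z.
  move=> za zb; rewrite permM tpermD //;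
    [apply: contraNneq za|apply: contraNneq zb] => E.
    by rewrite -ma E mK.
  by rewrite -mb E mK.
split.
  apply/partial_matchingP; split=> z.
    have [->|za] := eqVneq z a; first by rewrite Ea Eb.
    have [->|zb] := eqVneq z b; first by rewrite Eb Ea.
    rewrite (Ez z) // Ez ?mK //; [apply: contraNneq za|apply: contraNneq zb] => E.
      by rewrite -ma -E mK.
    by rewrite -mb -E mK.
  have [->|za] := eqVneq z a; first by rewrite Ea.
  have [->|zb] := eqVneq z b; first by rewrite Eb hC.
  by rewrite Ez //; apply: mh.
apply/setP => z; rewrite !inE; have [->|za] := eqVneq z a.
  by rewrite Ea eq_sym (negPf ab) andbF.
have [->|zb] := eqVneq z b; first by rewrite Eb (negPf ab).
by rewrite Ez.
Qed.

Lemma unmatch_pair m x : m \in partial_matchings -> m x != x ->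
  (m * tperm x (m x))%g \in partial_matchings /\
  unmatched (m * tperm x (m x))%g = x |: (m x |: unmatched m).
Proof.
move=> /partial_matchingP[mK mh] mx; set m' := (m * _)%g.
have Ex : m' x = x by rewrite permM tpermR.
have Ey : m' (m x) = m x by rewrite permM mK tpermL.
have Ez z : z != x -> z != m x -> m' z = m z.
  move=> zx zy; rewrite permM tpermD //; last by rewrite (inj_eq perm_inj) eq_sym.
  by apply: contraNneq zy => ->; rewrite mK.
split.
  apply/partial_matchingP; split=> z.
    have [->|zx] := eqVneq z x; first by rewrite !Ex.
    have [->|zy] := eqVneq z (m x); first by rewrite !Ey.
    rewrite (Ez z) // Ez ?mK //; last by rewrite (inj_eq perm_inj).
    by apply: contraNneq zy => <-; rewrite mK.
  have [->|zx] := eqVneq z x; first by rewrite Ex eqxx.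
  have [->|zy] := eqVneq z (m x); first by rewrite Ey eqxx.
  by rewrite Ez //; apply: mh.
apply/setP => z; rewrite !inE; have [->|zx] := eqVneq z x; first by rewrite Ex eqxx.
by have [->|zy] := eqVneq z (m x); rewrite ?Ey ?eqxx //= Ez.
Qed.

(** Take a maximum matching with two unmatched vertices [u], [u']. Without augmenting paths of
    length one or three, the neighbours of [u] and the partners of the neighbours of [u'] are
    disjoint sets of matched vertices, of size at least [d] each. *)
Lemma large_matching : exists m : {perm T}, [/\ involutive m, 
  forall x, m x != x -> h x (m x) &
  (#|unmatched m| <= 1) || (#|unmatched m| + 2 * d <= #|T|)].
Proof.
have one : (1%g : {perm T}) \in partial_matchings.
  by apply/partial_matchingP; split=> x; rewrite !perm1 ?eqxx.
case: (arg_minnP (fun m => #|unmatched m|) one) => m mQ mmin.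
have [mK mh] := partial_matchingP _ mQ.
exists m; split=> //; have [//|/card_gt1P[u [u' [uU u'U uu']]]] := leqP; apply/orP;
  right.
rewrite !inE in uU u'U; move/eqP in uU; move/eqP in u'U.
have free v y : m v = v -> h v y -> m y != y.
  move=> mv hvy; apply/eqP => my; have [Q E] := match_pair mQ hvy mv my.
  have := mmin _ Q; rewrite E (cardsD1 v (unmatched m)) inE mv eqxx add1n leqNgt ltnS.
  by rewrite subset_leq_card // subD1set.
(* Otherwise the pair of [x] and [m x] is replaced by the pairs [u], [x] and [u'], [m x]. *)
have aug x : h u x -> ~~ h u' (m x).
  move=> hux; apply/negP => hu'y; have mx := free u x uU hux.
  have [Q1 E1] := unmatch_pair mQ mx; set m1 := (m * _)%g in Q1 E1.
  have ux : u != x by apply: contraTneq hux => ->.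
  have uy : u != m x by apply: contraNneq mx => E; rewrite -E -{1}uU E mK eqxx.
  have u'x : u' != x by apply: contraNneq mx => <-; rewrite u'U.
  have u'y : u' != m x by apply: contraNneq mx => E; rewrite -E -{1}u'U E mK eqxx.
  have fixE (m' : {perm T}) z : z \in unmatched m' -> m' z = z by rewrite inE => /eqP.
  have [] := match_pair Q1 hux; [apply: fixE|apply: fixE|].
  - by rewrite E1 !inE uU eqxx !orbT.
  - by rewrite E1 !inE eqxx.
  set m2 := (m1 * _)%g => Q2 E2.
  have [] := match_pair Q2 hu'y; [apply: fixE|apply: fixE|].
  - by rewrite E2 E1 !inE u'x eq_sym uu' u'U eqxx !orbT.
  - by rewrite E2 E1 !inE mx eq_sym uy eqxx !orbT.
  set m3 := (m2 * _)%g => Q3 E3.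
  have := mmin _ Q3; rewrite E3 E2 E1 (cardsD1 u (unmatched m)) inE uU eqxx add1n
    leqNgt ltnS.
  rewrite subset_leq_card //; apply/subsetP => z; rewrite !inE.
  by case/and5P=> /negPf-> _ /negPf-> ->.
pose A := [set y | h u y]; pose B := m @: [set y | h u' y].
have dis : [disjoint A & B].
  rewrite disjoint_subset; apply/subsetP => x; rewrite !inE => hux.
  by apply/imsetP => -[y]; rewrite inE => hy E; have := aug x hux; rewrite E mK hy.
have sub : A :|: B \subset ~: unmatched m.
  apply/subsetP => x; rewrite !inE => /orP[|/imsetP[y]]; first exact: free.
  by rewrite inE => /free H ->; rewrite (inj_eq perm_inj) H.
have := subset_leq_card sub; rewrite cardsU disjoint_setI0 // cards0 subn0.
rewrite card_imset; last exact: perm_inj.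
have := degh u; have := degh u'; have := cardsC (unmatched m); rewrite -/A; clear.
by move: #|A| #|[set _ | _]| #|unmatched m| #|~: _| #|T| => ?????; lia.
Qed.

End Matching.

(** * Perfect matchings as pairings *)

Section Translation.
Variable T : finType.
Implicit Types (g : {perm T}) (M E : {set {set T}}) (x y : T).

Definition pairing_edges g : {set {set T}} := [set [set x; g x] | x : T].

Lemma pairing_edges_mem g x : [set x; g x] \in pairing_edges g.
Proof. exact: imset_f. Qed.

Lemma pairing_edge_through g x e : involutive g ->
  e \in pairing_edges g -> x \in e -> e = [set x; g x].
Proof.
move=> gK /imsetP[z _ ->]; rewrite !inE => /orP[/eqP->//|/eqP->].
by rewrite gK setUC.
Qed.

Lemma pairing_edges_matching g : g \in pairings T -> perfect_matching (pairing_edges g).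
Proof.
case/pairingP=> gK gN; apply/andP; split.
  by apply/forall_inP => _ /imsetP[x _ ->]; rewrite cards2 (eq_sym x) gN.
apply/forallP => x; apply/cards1P; exists [set x; g x].
apply/setP => e; rewrite !inE; apply/andP/eqP => [[eE xe]|->].
  exact: pairing_edge_through eE xe.
by split; [apply: pairing_edges_mem|apply: set21].
Qed.

Lemma pairing_edges_inj : {in pairings T &, injective pairing_edges}.
Proof.
move=> g g' /pairingP[gK gN] /pairingP[g'K g'N] E; apply/permP => x.
have : [set x; g x] \in pairing_edges g' by rewrite -E pairing_edges_mem.
move=> /(pairing_edge_through g'K)/(_ (set21 _ _)) /setP/(_ (g x)).
by rewrite !inE eqxx orbT (negPf (gN x)) => /esym/eqP.
Qed.

(** Each vertex lies in exactly one edge, whose other end defines its mate. *)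
Lemma matching_pairing M : perfect_matching M ->
  exists2 g, g \in pairings T & M = pairing_edges g.
Proof.
case/andP=> /forall_inP M2 /forallP M1.
have Mu x e e' : e \in M -> e' \in M -> x \in e -> x \in e' -> e = e'.
  move=> eM e'M xe xe'; have /cards1P[f Ef] := M1 x.
  have : e \in [set e in M | x \in e] by rewrite inE eM.
  have : e' \in [set e in M | x \in e] by rewrite inE e'M.
  by rewrite Ef !inE => /eqP-> /eqP->.
have Mex x : exists y, (y != x) && ([set x; y] \in M).
  have /cards1P[f Ef] := M1 x.
  have : f \in [set e in M | x \in e] by rewrite Ef inE.
  rewrite inE => /andP[fM xf]; have /cards2P[a [b [ab Eab]]] := M2 f fM.
  move: xf; rewrite Eab !inE => /orP[]/eqP->.
    by exists b; rewrite eq_sym ab -Eab.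
  by exists a; rewrite ab setUC -Eab.
pose mate x := xchoose (Mex x).
have mateP x : (mate x != x) && ([set x; mate x] \in M) := xchooseP (Mex x).
have mateK : involutive mate.
  move=> x; have /andP[n1 e1] := mateP x; have /andP[n2 e2] := mateP (mate x).
  have /setP/(_ (mate (mate x))) := Mu (mate x) _ _ e1 e2 (set22 _ _) (set21 _ _).
  by rewrite !inE eqxx orbT (negPf n2) orbF => /eqP.
pose g := perm (can_inj mateK).
have gE x : g x = mate x by rewrite permE.
exists g.
  apply/pairingP; split=> x; rewrite !gE ?mateK //.
  by have /andP[] := mateP x.
apply/setP => e; apply/idP/imsetP => [eM|[x _ ->]].
  have /cards2P[a [b [ab Eab]]] := M2 e eM; exists a => //; rewrite gE.
  apply: (Mu a) => //; first by have /andP[] := mateP a.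
    by rewrite Eab set21.
  by rewrite set21.
by rewrite gE; have /andP[] := mateP x.
Qed.

Lemma card_matchings (P : pred {set {set T}}) :
  #|[set M | perfect_matching M & P M]| =
  #|[set g in pairings T | P (pairing_edges g)]|.
Proof.
have inj : {in [set g in pairings T | P (pairing_edges g)] &, injective pairing_edges}.
  move=> g g'; rewrite [g \in _]in_set [g' \in _]in_set => /andP[gI _] /andP[g'I _].
  exact: pairing_edges_inj.
rewrite -(card_in_imset inj); apply: eq_card => M; rewrite [M \in _]in_set.
apply/andP/imsetP => [[/matching_pairing[g gI ->] Pg]|[g + ->]].
  by exists g => //; rewrite in_set gI.
by rewrite in_set => /andP[gI ->]; split=> //; apply: pairing_edges_matching.
Qed.

Lemma cycles_pancyclic E g :
    (forall k, 3 <= k <= #|T| -> exists c,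
      [/\ path.cycle (union_adj (adjacent E) g) c, uniq c & size c = k]) ->
  pancyclic (E :|: pairing_edges g).
Proof.
move=> H; apply/forallP => k; apply/implyP => k3.
have [|c [cc uc sc]] := H k; first by rewrite k3 -ltnS ltn_ord.
move/eqP in sc; apply/existsP; exists (Tuple sc); rewrite /ucycleb /= uc andbT.
apply: sub_cycle cc => x y /= /orP[|/eqP<-]; rewrite /adjacent /= inE;
  first by move=> ->.
by rewrite pairing_edges_mem orbT.
Qed.

Lemma adjacent_sym E : symmetric (adjacent E).
Proof. by move=> x y; rewrite /adjacent /= setUC. Qed.

Lemma adjacent_irr E x : simple_graph E -> ~~ adjacent E x x.
Proof.
by move=> /forall_inP H; apply/negP => /H; rewrite setUid cards1.
Qed.

Lemma min_degree_le E x : simple_graph E -> min_degree E <= #|[set y | adjacent E x y]|.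
Proof.
move=> /forall_inP H; apply: (@leq_trans (degree E x)).
  rewrite /min_degree; elim: (index_enum T) (mem_index_enum x) => //= y s IH.
  rewrite inE big_cons => /orP[/eqP<-|/IH le]; first exact: geq_minl.
  by apply: leq_trans (geq_minr _ _) le.
apply: leq_trans (leq_imset_card (fun y => [set x; y]) _).
apply/subset_leq_card/subsetP => e; rewrite inE => /andP[eE xe].
have /cards2P[a [b [ab Eab]]] := H e eE.
move: xe; rewrite Eab !inE => /orP[]/eqP->; apply/imsetP.
  by exists b => //; rewrite inE /adjacent /= -Eab.
by exists a; [rewrite inE /adjacent /= setUC -Eab|rewrite setUC].
Qed.

End Translation.

Lemma pairings_neq0 n : ~~ odd n -> 0 < #|pairings 'I_n|.
Proof.
(* Order reversal fixes only a middle point, which does not exist for even [n]. *)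
move=> n_even; apply/card_gt0P; exists (perm (@rev_ord_inj n)).
apply/pairingP; split=> i; rewrite !permE ?rev_ordK //.
apply: contra n_even => /eqP/(congr1 val) /= E.
by have := ltn_ord i; move: E; lia.
Qed.

(** * Short loops and the demand on insertion edges *)

Section Counting.
Variables (T : finType) (h : rel T) (m : T -> T) (K : nat).
Hypotheses (hC : symmetric h) (mK : involutive m).
Hypothesis mh : forall x, m x != x -> h x (m x).
Hypothesis K_gt0 : 0 < K.

Definition short_loops (g : {perm T}) : {set T} :=
  [set v | [exists l : 'I_K, (0 < l) && loop g m l v]].

(* What all_cycle_lengths asks of #|avail x y| for w = n / K + 1, L + 1 = K,
   q = 3 (n / (48 K^2)) and at most n / K vertices on short loops. *)
Definition demand := (#|T| %/ K).+1 + 16 * K * (3 * (#|T| %/ (48 * K ^ 2)))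
  + #|[set x | m x == x]| + 4 * (#|T| %/ K).

(** Markov's inequality for the number of vertices on short loops, whose mean is bounded by
    [loop_count] for each vertex and each length below [K]. *)
Lemma short_loops_count :
  #|[set g in pairings T | #|T| %/ K < #|short_loops g|]|
    * ((#|T| %/ K).+1 * (#|T| - 2 * K)) <= #|T| * K * #|pairings T|.
Proof.
set B := [set _ in _ | _]; set c := _ %/ _.
rewrite mulnA; apply: (@leq_trans ((\sum_(g in pairings T) #|short_loops g|) * (#|T| -
  2 * K))).
  rewrite leq_mul2r; apply/orP; right.
  rewrite -sum_nat_const [leqRHS](bigID (fun g => c < #|short_loops g|)) /=.
  apply: leq_trans (leq_addr _ _).
  rewrite [leqRHS](eq_bigl (mem B)) => [|g]; last by rewrite [RHS]in_set.
  by apply: leq_sum => g; rewrite in_set => /andP[].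
apply: (@leq_trans ((\sum_(v : T) \sum_(l < K | 0 < l) #|[set g in pairings T | loop g
  m l v]|)
    * (#|T| - 2 * K))).
  rewrite leq_mul2r; apply/orP; right.
  apply: (@leq_trans (\sum_(g in pairings T) \sum_(v : T) \sum_(l < K | 0 < l) loop g
    m l v)).
    apply: leq_sum => g _; rewrite -sum1_card big_mkcond /=; apply: leq_sum => v _.
    rewrite inE; case: existsP => // -[l /andP[l0 lp]].
    by rewrite (bigD1 l) //= lp.
  rewrite exchange_big /=; apply: leq_sum => v _; rewrite exchange_big /=.
  apply: leq_sum => l _; rewrite -sum1_card [leqRHS]big_mkcond /= big_mkcond /=.
  by apply: leq_sum => g _; rewrite [_ \in [set _ in _ | _]]in_set; case: (g \in _);
    case: loop.
rewrite -mulnA -sum_nat_const big_distrl /=; apply: leq_sum => v _.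
rewrite big_distrl /= -[K in leqRHS]card_ord -sum_nat_const [leqRHS](bigID (fun l :
  'I_K => 0 < l)) /=.
apply: leq_trans (leq_addr _ _); apply: leq_sum => l l0.
apply: leq_trans (loop_count v mK l0); rewrite leq_mul2l leq_sub2l ?orbT //.
by rewrite leq_mul2l ltnW ?orbT.
Qed.

(** Bernoulli's inequality for (1 + 1/K)^j with denominators cleared. *)
Lemma bernoulli j : K ^ j * (K + j) <= K * K.+1 ^ j.
Proof.
elim: j => [|j IH]; first by rewrite !expn0 mul1n addn0 muln1.
have le : K ^ j <= K.+1 ^ j by case: (j) => // i; rewrite leq_exp2r.
rewrite !expnS; move: (K ^ j) (K.+1 ^ j) IH le => a b IH le.
have : K * (a * (K + j)) <= K * (K * b) by rewrite leq_mul2l IH orbT.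
have : K * a <= K * b by rewrite leq_mul2l le orbT.
by clear; nia.
Qed.

(** The exponent [3 * q] makes Bernoulli's inequality yield a cube of a quantity linear in the
    number of vertices, which beats the square counting the pairs to be covered. *)
Lemma demand_cycles (g : {perm T}) :
    0 < #|T| -> #|T| ^ 2 * K ^ 3 < (K + #|T| %/ (48 * K ^ 2)) ^ 3 ->
    g \in pairings T -> (forall x y, demand <= #|avail h g x y|) ->
    #|short_loops g| <= #|T| %/ K ->
  forall k, 3 <= k <= #|T| ->
    exists c, [/\ path.cycle (union_adj h g) c, uniq c & size c = k].
Proof.
move=> T_gt0 large /pairingP[gK gN] av leB.
set q := _ %/ (48 * _) in large.
have ltTKw : #|T| < K.+1 * (#|T| %/ K).+1.
  by rewrite mulSn mulnC; apply: leq_trans (ltn_ceil _ K_gt0) (leq_addl _ _).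
apply: (@all_cycle_lengths _ h g m hC gK gN mK mh K (#|T| %/ K).+1 (3 * q) K.-1
  (short_loops g)) => //.
- rewrite -(ltn_pmul2l (m := K ^ 3)) ?expn_gt0 ?K_gt0 //.
  apply: (@leq_trans (K ^ (3 * q) * (K + q) ^ 3)).
    rewrite mulnA mulnC [K ^ 3 * _]mulnC mulnn.
    by rewrite ltn_pmul2l ?expn_gt0 ?K_gt0.
  rewrite mulnC !(mulnC 3) !expnM -!expnMn leq_exp2r //.
  by rewrite mulnC bernoulli.
- move=> v l /andP[l0 lK] lp; rewrite inE; apply/existsP.
  have ltlK : l < K by rewrite -(prednK K_gt0) ltnS.
  by exists (Ordinal ltlK); rewrite /= l0.
- move=> x y; apply: leq_trans (av x y); rewrite /demand prednK // -/q.
  move: leB; clear; move: #|short_loops g| (#|T| %/ K) (16 * K * _) #|[set _ | _]| =>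
    ????; lia.
Qed.

End Counting.

(** * Concentration by exposing edges *)

Section Fibres.
Variable T : finType.
Implicit Types (g : {perm T}) (S : {set T}).

(** The state of the exposure: the edges outside [S] are revealed, and [g0] is one possible
    completion. *)
Definition fibre g0 S : {set {perm T}} :=
  [set g in pairings T | [forall x, (x \notin S) ==> (g x == g0 x)]].

Lemma fibreP g0 S g : reflect (g \in pairings T /\ forall x, x \notin S -> g x = g0 x)
  (g \in fibre g0 S).
Proof.
rewrite [g \in fibre g0 S]in_set; apply: (iffP andP) => -[gI H]; split=> //.
  by move=> x xS; apply/eqP; have := forallP H x; rewrite xS.
by apply/forallP => x; apply/implyP => xS; rewrite H.
Qed.

Section Split.
Variables (g0 : {perm T}) (S : {set T}) (v : T).
Hypotheses (g0I : g0 \in pairings T) (S0 : forall x, x \in S -> g0 x \in S).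
Hypothesis vS : v \in S.

Lemma fibre_self : g0 \in fibre g0 S.
Proof. exact/fibreP. Qed.

Lemma notin_closed (g : {perm T}) x : g \in pairings T -> (forall x, x \in S -> g x
  \in S) ->
  x \notin S -> g x \notin S.
Proof.
by move=> /pairingP[gK _] H; apply: contra => /H; rewrite gK.
Qed.

Lemma fibre_closed g x : g \in fibre g0 S -> x \in S -> g x \in S.
Proof.
case/fibreP=> /pairingP[gK gN] H xS; apply/negPn/negP => gxS.
have := H _ gxS; rewrite gK => E.
by have := notin_closed g0I S0 gxS; rewrite -E xS.
Qed.

Lemma fibre_conj g a b : a \in S -> b \in S -> g \in fibre g0 S ->
  (g ^ tperm a b)%g \in fibre g0 S.
Proof.
move=> aS bS gF; have [gI H] := fibreP _ _ _ gF; apply/fibreP; split.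
  exact: pairing_conj.
move=> x xS; rewrite conj_tpermE.
have fixed z : z \notin S -> tperm a b z = z.
  by move=> zS; rewrite tpermD //; apply: contraNneq zS => <-.
by rewrite (fixed x) // fixed H //; apply: notin_closed.
Qed.

Definition branch w := [set g in fibre g0 S | g v == w].

Lemma branch_conj w w' g : w \in S :\ v -> w' \in S :\ v ->
  g \in branch w -> (g ^ tperm w w')%g \in branch w'.
Proof.
rewrite !in_setD1 => /andP[wv wS] /andP[w'v w'S].
rewrite [g \in _]in_set => /andP[gF /eqP gv]; rewrite in_set fibre_conj //=.
by rewrite conj_tpermE [tperm w w' v]tpermD // gv tpermL.
Qed.

Lemma branch_sum (V : nmodType) (phi : {perm T} -> V) w w' : w \in S :\ v -> w' \in S
  :\ v ->
  (\sum_(g in branch w') phi g = \sum_(g in branch w) phi (g ^ tperm w w')%g)%R.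
Proof.
move=> wS w'S; rewrite (reindex_inj (@conjg_inj _ (tperm w w'))) /=.
apply: eq_bigl => g; apply/idP/idP => [H|]; last exact: branch_conj.
by have := branch_conj w'S wS H; rewrite [tperm w' w]tpermC conj_tpermK.
Qed.

(** Revealing the mate of [v] leaves a fibre with two free points fewer; conjugating [g0] provides
    its completion, so the induction can continue. *)
Lemma branch_fibre w : w \in S :\ v ->
  let g1 := (g0 ^ tperm (g0 v) w)%g in
  [/\ g1 \in pairings T, forall x, x \in S :\ v :\ w -> g1 x \in S :\ v :\ w &
      branch w = fibre g1 (S :\ v :\ w)].
Proof.
rewrite in_setD1 => /andP[wv wS] g1.
have [g0K g0N] := pairingP _ g0I.
have g1F : g1 \in fibre g0 S by apply: fibre_conj; rewrite ?S0 ?fibre_self.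
have [g1I g1H] := fibreP _ _ _ g1F.
have [g1K g1N] := pairingP _ g1I.
have g1v : g1 v = w.
  by rewrite /g1 conj_tpermE [tperm _ _ v]tpermD // tpermL.
have g1w : g1 w = v by rewrite -g1v g1K.
split=> //.
  move=> x; rewrite !in_setD1 => /and3P[xw xv xS].
  rewrite (fibre_closed g1F) // andbT; apply/andP; split.
    by apply: contraNneq xv => E; rewrite -(g1K x) E g1w.
  by apply: contraNneq xw => E; rewrite -(g1K x) E g1v.
apply/setP => g; rewrite in_set; apply/andP/fibreP.
  case=> /fibreP[gI gH] /eqP gv; split=> // x.
  have [gK gN] := pairingP _ gI.
  rewrite !in_setD1 !negb_and !negbK => /or3P[/eqP->|/eqP->|xS].
  - by rewrite g1w -gv gK.
  - by rewrite g1v.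
  - by rewrite gH // g1H.
case=> gI gH; split; last by rewrite gH ?g1v // !in_setD1 eqxx andbF.
apply/fibreP; split=> // x xS; rewrite gH ?g1H //.
by rewrite !in_setD1 (negPf xS) !andbF.
Qed.

End Split.

End Fibres.

Local Open Scope ring_scope.

(** * Exponential moments and the lower tail *)

Section Exposure.
Variable R : realType.

(** From exp(-x) >= 1 - x, since (1 - x)(1 + x + 2x^2) = 1 + x^2 (1 - 2x) >= 1. *)
Lemma expR_le_quadratic (x : R) : x <= 1 / 2 -> expR x <= 1 + x + 2 * x ^+ 2.
Proof.
move=> x2; have : 1 - x <= expR (- x) by rewrite expR_ge1Dx.
rewrite expRN => H; have e0 := expR_gt0 x.
have : (1 - x) * expR x <= 1.
  by rewrite -[leRHS](@mulVf _ (expR x)) ?lt0r_neq0 // ler_pM2r.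
move=> H2; have x1 : 0 < 1 - x by lra.
rewrite -(ler_pM2l x1); apply: le_trans H2 _.
have -> : (1 - x) * (1 + x + 2 * x ^+ 2) = 1 + x ^+ 2 * (1 - 2 * x) by ring.
by rewrite lerDl mulr_ge0 ?sqr_ge0 //; lra.
Qed.

(** All values lie within [c] of their average; in the quadratic bound around it the linear terms
    sum to zero. *)
Lemma exp_average (I : finType) (J : {set I}) (mu : I -> R) (c lam : R) :
    (0 < #|J|)%N -> (forall i j, i \in J -> j \in J -> `|mu i - mu j| <= c) ->
    `|lam| * c <= 1 / 2 ->
  \sum_(i in J) expR (lam * mu i) <=
    #|J|%:R * expR (lam * ((\sum_(i in J) mu i) / #|J|%:R) + 2 * (lam * c) ^+ 2).
Proof.
move=> J0 lip lamc; set avg := _ / _.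
have JR : 0 < #|J|%:R :> R by rewrite ltr0n.
have sum_avg : \sum_(i in J) avg = \sum_(i in J) mu i.
  by rewrite sumr_const -mulr_natr /avg divfK ?lt0r_neq0.
have c_ge0 : 0 <= c.
  by case/card_gt0P: J0 => i iJ; have := lip i i iJ iJ; rewrite subrr normr0.
have close i : i \in J -> `|mu i - avg| <= c.
  move=> iJ; rewrite -(ler_pM2l JR) -[X in X * `|_|](@gtr0_norm _ #|J|%:R) // -normrM.
  have -> : #|J|%:R * (mu i - avg) = \sum_(j in J) (mu i - mu j).
    by rewrite sumrB sumr_const -sum_avg sumr_const mulrBr !mulr_natl.
  apply: le_trans (ler_norm_sum _ _ _) _.
  by rewrite mulr_natl -sumr_const; apply: ler_sum => j jJ; apply: lip.
have step i : i \in J -> expR (lam * mu i) <=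
    expR (lam * avg) * (1 + lam * (mu i - avg) + 2 * (lam * c) ^+ 2).
  move=> iJ; have -> : lam * mu i = lam * avg + lam * (mu i - avg) by ring.
  rewrite expRD ler_pM2l ?expR_gt0 //.
  have nb : `|lam * (mu i - avg)| <= `|lam| * c by rewrite normrM ler_wpM2l ?close.
  apply: le_trans (expR_le_quadratic _) _.
    by apply: le_trans (ler_norm _) (le_trans nb lamc).
  rewrite lerD2l ler_pM2l // -[X in X <= _]real_normK ?num_real // -[leRHS]real_normK
    ?num_real //.
  by rewrite ler_sqr ?nnegrE // [leRHS]normrM (ger0_norm c_ge0).
apply: le_trans (ler_sum _ step) _.
rewrite -mulr_sumr !big_split /= -mulr_sumr sumrB sum_avg subrr mulr0 addr0.
rewrite !sumr_const -mulrnDl expRD -[X in _ * X <= _]mulr_natl [leLHS]mulrCA.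
by rewrite !ler_pM2l ?expR_gt0 // expR_ge1Dx.
Qed.

Variable T : finType.
Implicit Types (g : {perm T}) (S : {set T}).

Variables (F : {perm T} -> R) (c lam : R).
Hypothesis lip : forall g a b, g \in pairings T ->
  `|F (g ^ tperm a b)%g - F g| <= c.
Hypothesis lamc : `|lam| * c <= 1 / 2.

(* The branches of a fibre, according to the mate of one point v, are exchanged
   by conjugation with transpositions, so their means differ by at most c. *)
Lemma exp_moment_fibre k g0 S : (#|S| <= k)%N -> g0 \in pairings T ->
    (forall x, x \in S -> g0 x \in S) ->
  \sum_(g in fibre g0 S) expR (lam * F g) <= #|fibre g0 S|%:R *
    expR (lam * ((\sum_(g in fibre g0 S) F g) / #|fibre g0 S|%:R)
          + #|S|%:R * (2 * (lam * c) ^+ 2)).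
Proof.
elim: k g0 S => [|k IH] g0 S szS g0I S0.
  have S_0 : S = set0 by apply/eqP; rewrite -cards_eq0 -leqn0.
  have -> : fibre g0 S = [set g0]%SET.
    apply/setP => g; rewrite in_set1; apply/fibreP/eqP => [[_ H]|->]; last by split.
    by apply/permP => x; apply: H; rewrite S_0 in_set0.
  by rewrite !big_set1 cards1 divr1 mul1r S_0 cards0 mul0r addr0.
have [S_0|[v vS]] := set_0Vmem S.
  by apply: IH => //; rewrite S_0 cards0.
pose J := S :\ v.
have g0v : g0 v \in J.
  by rewrite in_setD1 S0 // andbT; have [_ ->] := pairingP _ g0I.
have J0 : (0 < #|J|)%N by apply/card_gt0P; exists (g0 v).
pose Br := branch g0 S v; pose N' := #|Br (g0 v)|.
have split_sum (phi : {perm T} -> R) :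
    \sum_(g in fibre g0 S) phi g = \sum_(w in J) \sum_(g in Br w) phi g.
  rewrite (partition_big (fun g : {perm T} => g v) (mem J)) /=.
    by apply: eq_bigr => w _; apply: eq_bigl => g; rewrite /Br /branch [in RHS]in_set.
  move=> g gF; rewrite in_setD1 (fibre_closed g0I S0 gF vS) andbT.
  by have [/pairingP[_ ->]] := fibreP _ _ _ gF.
have cardBr w : w \in J -> #|Br w|%:R = N'%:R :> R.
  move=> wJ; rewrite /N' -!sum1_card !natr_sum.
  exact: (branch_sum g0I S0 (fun=> 1%:R) g0v wJ).
have N'0 : 0 < N'%:R :> R.
  by rewrite ltr0n; apply/card_gt0P; exists g0; rewrite in_set fibre_self //=.
pose M w := \sum_(g in Br w) F g.
pose mu w := M w / N'%:R.
have muL w w' : w \in J -> w' \in J -> `|mu w - mu w'| <= c.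
  move=> wJ w'J; rewrite /mu -mulrBl normrM normfV [`|N'%:R|]gtr0_norm // ler_pdivrMr
    //.
  rewrite /M distrC (branch_sum g0I S0 F wJ w'J) -sumrB -(cardBr w wJ).
  apply: le_trans (ler_norm_sum _ _ _) _; rewrite mulr_natr -sumr_const.
  apply: ler_sum => g; rewrite in_set => /andP[/fibreP[gI _] _]; exact: lip.
have cardF : #|fibre g0 S|%:R = #|J|%:R * N'%:R :> R.
  rewrite -[#|fibre _ _|]sum1_card natr_sum (split_sum (fun=> 1%:R)).
  rewrite mulr_natl -sumr_const; apply: eq_bigr => w wJ.
  by rewrite -natr_sum sum1_card cardBr.
have mean : (\sum_(g in fibre g0 S) F g) / #|fibre g0 S|%:R = (\sum_(w in J) mu w) /
  #|J|%:R.
  by rewrite split_sum cardF /mu -mulr_suml invfM [_^-1 * _]mulrC mulrA.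
have cS : (#|S| = #|J|.+1)%N by rewrite (cardsD1 v S) vS.
(* The branches have fewer than [#|J|] free points, so [E] bounds their exponents; averaging over
   [w] adds the one further summand of [#|S| = #|J| + 1]. *)
pose E := #|J|%:R * (2 * (lam * c) ^+ 2).
have IHw w : w \in J -> \sum_(g in Br w) expR (lam * F g) <= N'%:R * expR E * expR
  (lam * mu w).
  move=> wJ; have [g1I g1S EB] := branch_fibre g0I S0 vS wJ.
  have cS' : (#|S :\ v :\ w| < #|J|)%N by rewrite [#|J|](cardsD1 w) wJ.
  have szk : (#|S :\ v :\ w| <= k)%N by apply: leq_trans (ltnW cS') _;
    rewrite -ltnS -cS.
  have := IH _ _ szk g1I g1S; rewrite -EB -/(Br w) cardBr // -/(M w) -/(mu w).
  move=> H; apply: le_trans H _.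
  rewrite -mulrA ler_pM2l // -expRD ler_expR addrC lerD2r /E.
  apply: ler_wpM2r; first by rewrite mulr_ge0 ?sqr_ge0.
  by rewrite ler_nat ltnW.
rewrite split_sum; apply: le_trans (ler_sum _ IHw) _.
rewrite -mulr_sumr mean cardF.
have := exp_average J0 muL lamc; set X := expR _ => H.
apply: le_trans (ler_wpM2l _ H) _; first by rewrite mulr_ge0 ?expR_ge0 // ltW.
rewrite cS -natr1 mulrDl mul1r -/E.
have -> : N'%:R * expR E * (#|J|%:R * X) = #|J|%:R * N'%:R * (expR E * X) by ring.
rewrite /X -expRD ler_pM2l; last by rewrite mulr_gt0 // ltr0n.
by rewrite ler_expR addrCA.
Qed.

(** The exponential Markov inequality with nonpositive [lam], for the fibre in which nothing is
    revealed. *)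
Lemma lower_tail mu t : lam <= 0 ->
    mu * #|pairings T|%:R <= \sum_(g in pairings T) F g ->
  #|[set g in pairings T | F g < mu - t]|%:R <=
    #|pairings T|%:R * expR (lam * t + #|T|%:R * (2 * (lam * c) ^+ 2)).
Proof.
move=> lam_le0 le_mu; set I := pairings T in le_mu *; set B := [set g in I | _].
have [I0|/card_gt0P[g0 g0I]] := posnP #|I|.
  suff -> : #|B| = 0%N by rewrite I0 mul0r.
  by apply/eqP; rewrite -leqn0 -I0 subset_leq_card //; apply/subsetP => g;
    rewrite in_set => /andP[].
have E : fibre g0 setT = I.
  by apply/setP => g; apply/fibreP/idP => [[]//|gI]; split=> // x; rewrite in_setT.
have N0 : 0 < #|I|%:R :> R by rewrite ltr0n; apply/card_gt0P; exists g0.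
have := @exp_moment_fibre #|T| g0 setT (max_card _) g0I (fun x _ => in_setT _).
rewrite E cardsT; set X := #|T|%:R * _; set mean := _ / _ => H.
have mu_mean : mu <= mean by rewrite ler_pdivlMr.
rewrite -(ler_pM2r (expR_gt0 (lam * (mu - t)))) -[leRHS]mulrA -expRD.
rewrite (_ : lam * t + X + lam * (mu - t) = lam * mu + X); last by ring.
apply: (@le_trans _ _ (#|I|%:R * expR (lam * mean + X))); last first.
  by rewrite ler_pM2l // ler_expR lerD2r ler_wnM2l.
apply: le_trans H; apply: (@le_trans _ _ (\sum_(g in B) expR (lam * F g))).
  rewrite mulr_natl -sumr_const; apply: ler_sum => g; rewrite in_set => /andP[_ Fg].
  by rewrite ler_expR ler_wnM2l // ltW.
rewrite [leRHS](bigID (fun g => F g < mu - t)) /= -[leLHS]addr0 lerD //.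
  by rewrite le_eqVlt; apply/orP; left; apply/eqP; apply: eq_bigl => g; rewrite in_set.
by apply: sumr_ge0 => g _; rewrite expR_ge0.
Qed.

End Exposure.

(** * The random matching *)

Lemma leq_card_union (I J : finType) (A B : {set I}) (C : J -> {set I}) :
  (forall g, g \in A -> (g \in B) \/ exists j, g \in C j) ->
  (#|A| <= #|B| + \sum_j #|C j|)%N.
Proof.
move=> H; rewrite -!sum1_card (eq_bigr (fun j => \sum_(g in C j) 1)%N) => [|j _];
  last by rewrite sum1_card.
rewrite (exchange_big_dep predT) //= [X in (X <= _)%N]big_mkcond /= [X in (_ <= X +
  _)%N]big_mkcond /=.
rewrite -big_split /=; apply: leq_sum => g _; case: ifP => // /H[->//|[j gj]].
by rewrite [X in (_ <= _ + X)%N](bigD1 j) //= addnCA leq_addr.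
Qed.

Section Tail.
Variables (R : realType) (T : finType) (h : rel T).
Hypothesis hC : symmetric h.

Lemma avail_tail (K d z : nat) (mu : R) x y :
    (0 < K)%N -> (1 < #|T|)%N ->
    (forall u, (d <= #|[set v | h u v]|)%N) ->
    mu * #|T|.-1%:R <= (d * d.-1)%:R -> z%:R <= mu - #|T|%:R / K%:R ->
  #|[set g in pairings T | (#|avail h g x y| < z)%N]|%:R <=
    #|pairings T|%:R * expR (- (#|T|%:R / (128 * K%:R ^+ 2))) :> R.
Proof.
move=> K0 T1 degh lemu lez; set I := pairings T; set n := #|T|%:R : R.
have KR : 1 <= K%:R :> R by rewrite ler1n.
have KR0 : K%:R != 0 :> R by rewrite gt_eqF // (lt_le_trans ltr01).
pose F (g : {perm T}) : R := #|avail h g x y|%:R.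
have lip (g : {perm T}) a b : g \in I -> `|F (g ^ tperm a b)%g - F g| <= 4.
  move=> _; have := avail_switch_sub h g a b x y.
  have := avail_switch_sub h (g ^ tperm a b)%g a b x y; rewrite conj_tpermK.
  rewrite -!(ler_nat R) !natrD ler_norml /F; lra.
(* With [c = 4] and t = n/K, this minimises lam t + 32 n lam^2; the minimum is -n/(128 K^2). *)
pose lam : R := - (64 * K%:R)^-1.
have lam0 : lam <= 0 by rewrite oppr_le0 invr_ge0 mulr_ge0 ?ler0n.
have lamc : `|lam| * 4 <= 1 / 2.
  rewrite ler0_norm // opprK mulrC ler_pdivrMr; last by lra.
  by lra.
have mean : mu * #|I|%:R <= \sum_(g in I) F g.
  have T0 : 0 < #|T|.-1%:R :> R by rewrite ltr0n -ltnS prednK // ltnW.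
  rewrite -(ler_pM2r T0) mulrAC; apply: le_trans (ler_wpM2r _ lemu) _;
    first exact: ler0n.
  by rewrite -natrM -natr_sum -natrM ler_nat mulnC [(_ * #|T|.-1)%N]mulnC mulnC
    avail_mean.
have := @lower_tail R T F 4 lam lip lamc mu (n / K%:R) lam0 mean.
set B := [set g in pairings T | _] => H.
apply: (@le_trans _ _ #|B|%:R).
  rewrite ler_nat subset_leq_card //; apply/subsetP => g.
  rewrite in_set => /andP[gI lt]; rewrite in_set gI /=.
  by apply: (lt_le_trans _ lez); rewrite /F ltr_nat.
apply: le_trans H _; rewrite le_eqVlt; apply/orP; left; apply/eqP.
congr (_ * expR _); rewrite -/n /lam; field; exact: KR0.
Qed.

Lemma cube_exp_bound (y : R) : 0 <= y -> (y / 3) ^+ 3 <= expR y.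
Proof.
move=> y0; have -> : expR y = expR (y / 3) ^+ 3.
  by rewrite -expRM_natl mulrC divfK.
apply: lerXn2r; rewrite ?nnegrE ?expR_ge0 //; first by lra.
by apply: le_trans (expR_ge1Dx _); rewrite lerDr.
Qed.

End Tail.

(** * The union bound on failures *)

Section Failure.
Variables (R : realType) (T : finType) (h : rel T) (d K : nat) (alpha : R).
Hypotheses (hC : symmetric h) (hN : forall x, ~~ h x x).
Hypothesis degh : forall x, (d <= #|[set y | h x y]|)%N.
Hypotheses (K_gt0 : (0 < K)%N) (alpha_gt0 : 0 < alpha).
Let n := #|T|.
Hypotheses (n_gt1 : (1 < n)%N) (leKn : (4 * K <= n)%N).
Hypothesis large : (n ^ 2 * K ^ 3 < (K + n %/ (48 * K ^ 2)) ^ 3)%N.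
Hypothesis led : alpha * n%:R <= d%:R.
Hypothesis slack1 : 7 * n%:R / K%:R + 3 <= alpha ^+ 2 * n%:R.
Hypothesis slack2 : 7 * n%:R / K%:R + 3 <= (alpha ^+ 2 + 2 * alpha - 1) * n%:R.
Variable good : pred {perm T}.
Hypothesis goodP : forall g, g \in pairings T ->
  (forall k, (3 <= k <= n)%N -> exists c,
    [/\ path.cycle (union_adj h g) c, uniq c & size c = k]) -> good g.

Lemma failure_count :
  #|[set g in pairings T | ~~ good g]|%:R <= #|pairings T|%:R *
    ((27 * (128 * K%:R ^+ 2) ^+ 3 + 2 * K%:R ^+ 2) / n%:R) :> R.
Proof.
have [m [mK mh mU]] := large_matching hC hN degh.
have n0 : 0 < n%:R :> R by rewrite ltr0n ltnW.
have K0 : 0 < K%:R :> R by rewrite ltr0n.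
have ledn : d%:R <= n%:R :> R.
  have [x _] : exists x : T, x \in T by apply/card_gt0P; rewrite ltnW.
  by rewrite ler_nat; apply: leq_trans (degh x) (max_card _).
set I := pairings T.
pose z := demand m K.
pose mu : R := alpha ^+ 2 * n%:R - 1.
have divK : (n %/ K)%:R <= n%:R / K%:R :> R.
  by rewrite ler_pdivlMr // -natrM ler_nat leq_divM.
(* The demand costs n/K for [w], n/K for the reservoir and 4n/K for loops and long chains; the
   deviation costs the seventh n/K. The two slacks match the two alternatives for the unmatched
   vertices. *)
have zmu : z%:R <= mu - n%:R / K%:R.
  have qK : (16 * K * (3 * (n %/ (48 * K ^ 2))))%:R <= n%:R / K%:R :> R.
    rewrite ler_pdivlMr // -natrM ler_nat; apply: leq_trans (leq_divM n (48 * K ^ 2)).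
    by rewrite leq_eqVlt; apply/orP; left; apply/eqP; rewrite -mulnn; ring.
  have uU : (#|unmatched m|%:R <= 1 :> R) \/ (#|unmatched m|%:R + 2 * d%:R <= n%:R :>
    R).
    by case/orP: mU => H; [left; rewrite lern1|right; rewrite -natrM -natrD ler_nat].
  rewrite /z /demand -/n -/(unmatched m) 3!natrD -natr1 [(4 * _)%:R]natrM /mu.
  set X := (16 * K * _)%:R in qK *; set U := #|unmatched m|%:R in uU *.
  have s1 := slack1; have s2 := slack2; have ld := led; move: divK s1 s2 ld uU qK.
  rewrite -[7 * _ / _]mulrA; move: (n%:R / K%:R : R) ((n %/ K)%:R : R) => a b.
  by move: X U (d%:R : R) (n%:R : R) => x u d' n' ????[]??; lra.
have lemu : mu * n.-1%:R <= (d * d.-1)%:R.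
  have d0 : (0 < d)%N by rewrite -(ltr0n R); apply: lt_le_trans led; rewrite mulr_gt0.
  rewrite natrM -!subn1 !natrB // ?(ltnW n_gt1) //.
  have H1 : (alpha * n%:R) ^+ 2 <= d%:R ^+ 2 by rewrite ler_sqr ?nnegrE ?mulr_ge0
    ?ler0n // ltW.
  have H2 : 3 <= alpha ^+ 2 * n%:R.
    by apply: le_trans slack1; rewrite lerDr divr_ge0 ?mulr_ge0 ?ler0n.
  rewrite /mu; move: H1; rewrite exprMn; nra.
pose B1 (p : T * T) := [set g in I | (#|avail h g p.1 p.2| < z)%N].
pose B2 := [set g in I | (n %/ K < #|short_loops m K g|)%N].
have sub : (#|[set g in I | ~~ good g]| <= #|B2| + \sum_p #|B1 p|)%N.
  apply: leq_card_union => g; rewrite in_set => /andP[gI ngood].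
  have [gB2|gB2] := boolP (g \in B2); [by left|right].
  have [/existsP[p gp]|nB1] := boolP [exists p, g \in B1 p]; first by exists p.
  case/negP: ngood; apply: goodP => // k.
  apply: (demand_cycles hC mK mh K_gt0 _ large gI); first exact: ltnW.
    move=> x y; rewrite leqNgt; apply: contra nB1 => lt.
    by apply/existsP; exists (x, y); rewrite in_set gI.
  by rewrite leqNgt; apply: contra gB2 => lt; rewrite in_set gI.
have B1le p : #|B1 p|%:R <= #|I|%:R * expR (- (n%:R / (128 * K%:R ^+ 2))) :> R.
  exact: avail_tail zmu.
have N0 : 0 <= #|I|%:R :> R by [].
set y : R := n%:R / (128 * K%:R ^+ 2) in B1le.
have K2 : 0 < 128 * K%:R ^+ 2 :> R by rewrite mulr_gt0 // exprn_gt0.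
have y0 : 0 < y by rewrite divr_gt0.
(* The square counts the pairs; the cubic lower bound on the exponential leaves a bound of order
   1/n. *)
have ebound : n%:R ^+ 2 * expR (- y) <= 27 * (128 * K%:R ^+ 2) ^+ 3 / n%:R.
  have y3 : 0 < (y / 3) ^+ 3 by rewrite exprn_gt0 // divr_gt0.
  have := cube_exp_bound (ltW y0); rewrite -lef_pV2 ?posrE ?expR_gt0 // -expRN => H.
  apply: le_trans (ler_wpM2l _ H) _; first by rewrite sqr_ge0.
  rewrite le_eqVlt; apply/orP; left; apply/eqP; rewrite /y; field.
  by rewrite !gt_eqF.
have sumB1 : (\sum_p #|B1 p|)%:R <= #|I|%:R * (27 * (128 * K%:R ^+ 2) ^+ 3 / n%:R) :> R.
  rewrite natr_sum; apply: le_trans (ler_sum _ (fun p _ => B1le p)) _.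
  rewrite sumr_const card_prod -/n -[leLHS]mulr_natl natrM -expr2 [leLHS]mulrCA.
  by rewrite ler_wpM2l.
have B2le : #|B2|%:R <= #|I|%:R * (2 * K%:R ^+ 2 / n%:R) :> R.
  have := short_loops_count K mK; rewrite -/n -/I -/B2.
  have a1 : n%:R / K%:R <= (n %/ K).+1%:R :> R.
    by rewrite ler_pdivrMr // -natrM ler_nat ltnW // ltn_ceil.
  have a2 : n%:R / 2 <= (n - 2 * K)%:R :> R.
    rewrite natrB; last by apply: leq_trans leKn; rewrite leq_mul2r orbT.
    by move: leKn; rewrite -(ler_nat R) !natrM; lra.
  rewrite -(ler_nat R) !natrM => H.
  have a3 : n%:R / K%:R * (n%:R / 2) <= (n %/ K).+1%:R * (n - 2 * K)%:R :> R.
    by apply: ler_pM => //; rewrite divr_ge0 // ltW.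
  have c0 : 0 < n%:R / K%:R * (n%:R / 2) :> R by rewrite mulr_gt0 // divr_gt0.
  rewrite -(ler_pM2r c0); apply: le_trans (ler_wpM2l (ler0n _ _) a3) (le_trans H _).
  rewrite le_eqVlt; apply/orP; left; apply/eqP; field.
  by rewrite !gt_eqF.
move: sub; rewrite -(ler_nat R) natrD => sub; apply: le_trans sub _.
by rewrite mulrDl mulrDr addrC lerD.
Qed.

End Failure.

(** With c = 48 K^2, already (K + n/c) c exceeds [n]; cubing and n >= K^3 c^3 give the claim. *)
Lemma large_cube (K n : nat) : (0 < K)%N -> (K ^ 3 * (48 * K ^ 2) ^ 3 <= n)%N ->
  (n ^ 2 * K ^ 3 < (K + n %/ (48 * K ^ 2)) ^ 3)%N.
Proof.
move=> K0; set c := (48 * K ^ 2)%N => len.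
have c0 : (0 < c)%N by rewrite muln_gt0 expn_gt0 K0.
have lt : (n < (K + n %/ c) * c)%N.
  by apply: leq_trans (ltn_ceil n c0) _;
    rewrite leq_mul2r -addn1 addnC leq_add2r K0 orbT.
rewrite -(ltn_pmul2r (m := c ^ 3)) ?expn_gt0 ?c0 // -expnMn.
apply: leq_ltn_trans (_ : n ^ 3 < _)%N; last by rewrite ltn_exp2r.
by rewrite -mulnA [(n ^ 3)%N]expnSr leq_mul2l len orbT.
Qed.

Theorem theorem1p2 (R : realType) (eps : R) (H : forall n : nat, {set {set 'I_n}}) :
  let alpha : R := (1 + eps) * (Num.sqrt 2 - 1) in
  0 < eps ->
  (forall n : nat, ~~ odd n ->
     simple_graph (H n) /\ alpha * n%:R <= (min_degree (H n))%:R) ->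
  (matching_prob R (fun G => pancyclic (H n :|: G))
     @[n --> within (fun n : nat => ~~ odd n) \oo] --> (1 : R))%classic.
Proof.
move=> alpha eps_gt0 HP.
have sq2 : Num.sqrt 2 ^+ 2 = 2 :> R by rewrite sqr_sqrtr.
have s1 : 1 < Num.sqrt 2 :> R by rewrite -[X in X < _]sqrtr1 ltr_sqrt ?ltr1n.
have alpha_gt0 : 0 < alpha by rewrite mulr_gt0 //; lra.
pose tau := alpha ^+ 2 + 2 * alpha - 1.
have tau_gt0 : 0 < tau.
  have gt : Num.sqrt 2 - 1 < alpha.
    by rewrite /alpha mulrDl mul1r ltrDl mulr_gt0 //; lra.
  (* The number sqrt 2 - 1 is the positive root of x^2 + 2x - 1. *)
  have -> : tau = (alpha - (Num.sqrt 2 - 1)) * (alpha + 1 + Num.sqrt 2) + (Num.sqrt 2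
    ^+ 2 - 2).
    by rewrite /tau; ring.
  by rewrite sq2 subrr addr0 mulr_gt0 //; lra.
pose b := Num.min tau (alpha ^+ 2).
have b_gt0 : 0 < b by rewrite lt_min tau_gt0 exprn_gt0.
(* This gives 8n/K <= b n, and 7n/K + 3 <= 8n/K once n >= 3K. *)
pose K := (Num.truncn (8 / b)).+1.
have Kb : 8 / b < K%:R by rewrite truncnS_gt.
have K_gt0 : (0 < K)%N by [].
have K0 : 0 < K%:R :> R by rewrite ltr0n.
pose C : R := 27 * (128 * K%:R ^+ 2) ^+ 3 + 2 * K%:R ^+ 2.
have C_gt0 : 0 < C by rewrite addr_gt0 // mulr_gt0 // ?exprn_gt0 // mulr_gt0 //
  exprn_gt0.
apply/cvgrPdist_le => e e_gt0.
(* The summands serve [large_cube], [leKn], [Ce] and [n_gt1] in this order. *)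
pose N := (K ^ 3 * (48 * K ^ 2) ^ 3 + 4 * K + Num.truncn (C / e) + 2)%N.
exists N => // n /= leNn n_even.
have [Hs Hd] := HP n n_even.
have n_gt1 : (1 < n)%N by apply: leq_trans leNn; rewrite /N addn2.
have n0 : 0 < n%:R :> R by rewrite ltr0n ltnW.
have leKn : (4 * K <= n)%N.
  by apply: leq_trans leNn; rewrite /N -!addnA addnCA leq_addr.
have large : (K ^ 3 * (48 * K ^ 2) ^ 3 <= n)%N by apply: leq_trans leNn;
  rewrite /N -!addnA leq_addr.
have Ce : C / n%:R <= e.
  rewrite ler_pdivrMr // mulrC -ler_pdivrMr // ltW //.
  apply: lt_le_trans (truncnS_gt _) _; rewrite ler_nat; apply: leq_trans leNn.
  by rewrite /N addn2 ltnS; apply/leqW/leq_addl.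
have slack r : b <= r -> 7 * n%:R / K%:R + 3 <= r * n%:R.
  move=> br; apply: (@le_trans _ _ (b * n%:R)); last by rewrite ler_pM2r.
  have h1 : 8 / K%:R <= b.
    by rewrite ler_pdivrMr // mulrC -ler_pdivrMr // ltW.
  have h2 : 3 <= n%:R / K%:R :> R.
    rewrite ler_pdivlMr // -natrM ler_nat; apply: leq_trans leKn.
    by rewrite leq_mul2r orbT.
  apply: (@le_trans _ _ (8 / K%:R * n%:R)); last by rewrite ler_pM2r.
  by rewrite -!mulrA [_^-1 * _]mulrC; lra.
pose T := 'I_n; have cT : #|T| = n by rewrite card_ord.
pose good (g : {perm T}) := pancyclic (H n :|: pairing_edges g).
have := @failure_count R T (adjacent (H n)) (min_degree (H n)) K alpha
  (@adjacent_sym _ (H n)) (fun x => adjacent_irr x Hs) (fun x => min_degree_le x Hs)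
    K_gt0 alpha_gt0.
rewrite cT => /(_ n_gt1 leKn (large_cube K_gt0 large) Hd (slack _ _) (slack _ _) good).
move=> /(_ _ _ _) fc.
have {fc} : #|[set g in pairings T | ~~ good g]|%:R <= #|pairings T|%:R * (C / n%:R)
  :> R.
  apply: fc; rewrite ?ge_min ?lexx ?orbT //.
  by move=> g gI cyc; apply: cycles_pancyclic; rewrite cT.
set I := pairings T => fc.
have I0 : 0 < #|I|%:R :> R by rewrite ltr0n pairings_neq0.
have E : #|I|%:R = #|[set g in I | good g]|%:R + #|[set g in I | ~~ good g]|%:R :> R.
  rewrite -natrD -(cardsID [set g | good g] I); congr (_%:R); congr (_ + _)%N;
    apply: eq_card => g;
    rewrite [in RHS]in_set ?in_setI ?in_setD in_set // andbC //.
have -> : matching_prob R (fun G => pancyclic (H n :|: G)) = #|[set g in I | good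
  g]|%:R / #|I|%:R.
  rewrite /matching_prob card_matchings; congr (_ / _%:R).
  rewrite -[RHS](eq_card (A := [set g in I | predT (pairing_edges g)]))
    -?card_matchings.
    by apply: eq_card => M; rewrite !in_set andbT.
  by move=> g; rewrite in_set andbT.
rewrite (_ : 1 - _ = #|[set g in I | ~~ good g]|%:R / #|I|%:R); last first.
  apply: (mulIf (lt0r_neq0 I0)); rewrite mulrBl mul1r !divfK ?lt0r_neq0 //.
  by rewrite E addrAC subrr add0r.
rewrite ger0_norm ?divr_ge0 // ler_pdivrMr // mulrC.
by apply: le_trans fc _; rewrite ler_pM2l.
Qed.
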